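(* Let $p\in(1,2)$, $m>0$, $k_{t3}>0$, $\kappa_t>1/2$, and let $k_{t1},k_{t2}>0$ be such that $\mathcal{A}_t=\begin{bmatrix}-k_{t1}&1\\-k_{t2}&0\end{bmatrix}$ is Hurwitz. Consider the translational motion of the vehicle $$\dot b=v,\qquad m\dot v=mg\,\mathbf{e}_3-fR\,\mathbf{e}_3+\varphi_D,$$ and the extended state observer with state $(\widehat b,\widehat v,\widehat\varphi_D)\in\mathbb{R}^3\times\mathbb{R}^3\times\mathbb{R}^3$ given by $$\dot{\widehat b}=\widehat v,$$ $$m\dot{\widehat v}=mg\,\mathbf{e}_3-fR\,\mathbf{e}_3+mk_{t1}\phi_1(\psi_t)+m\kappa_t\Big[(e_b^Te_b)^{\frac{1-p}{p}}H\Big(e_b,\frac{p-1}{p}\Big)e_v+e_v\Big]+\widehat\varphi_D,$$ $$\dot{\widehat\varphi}_D=mk_{t2}\phi_2(\psi_t),$$ where $e_b=b-\widehat b$, $e_v=v-\widehat v$, $e_\varphi=\varphi_D-\widehat\varphi_D$ and $$\psi_t=e_v+\kappa_t\Big[e_b+(e_b^Te_b)^{\frac{1-p}{p}}e_b\Big].$$ Then the estimation errors satisfy $$\dot e_b=e_v,$$ $$m\dot e_v=-mk_{t1}\phi_1(\psi_t)-m\kappa_t\Big[(e_b^Te_b)^{\frac{1-p}{p}}H\Big(e_b,\frac{p-1}{p}\Big)e_v+e_v\Big]+e_\varphi,$$ $$\dot e_\varphi=-mk_{t2}\phi_2(\psi_t)+\dot\varphi_D .$$ Moreover, when the resultant disturbance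 force is constant ($\dot\varphi_D=0$), this error dynamics is fast finite-time stable at the origin $(e_b,e_v,e_\varphi)=(0,0,0)$.
   Context: Here $b,v\in\mathbb{R}^3$ are the position and inertial-frame translational velocity, $R\in SO(3)$ the attitude, $f\in\mathbb{R}$ the scalar thrust, $m$ the mass, $g$ the gravitational acceleration, $\mathbf{e}_3=[0\ 0\ 1]^T$, and $\varphi_D\in\mathbb{R}^3$ the disturbance force. The functions $\phi_1,\phi_2:\mathbb{R}^3\to\mathbb{R}^3$ are $$\phi_1(x)=k_{t3}x+(x^Tx)^{\frac{1-p}{3p-2}}x,$$ $$\phi_2(x)=k_{t3}^2x+\frac{2k_{t3}(2p-1)}{3p-2}(x^Tx)^{\frac{1-p}{3p-2}}x+\frac{p}{3p-2}(x^Tx)^{\frac{2(1-p)}{3p-2}}x,$$ with $\phi_1(0)=\phi_2(0)=0$. The matrix-valued function $H$ is $$H(x,k)=I-\frac{2k}{x^Tx}xx^T,\qquad x\in\mathbb{R}^3\setminus\{0\},\ k\in\mathbb{R}.$$ Conventions at $e_b=0$: $(e_b^Te_b)^{\frac{1-p}{p}}e_b=0$ and $(e_b^Te_b)^{\frac{1-p}{p}}H(e_b,\frac{p-1}{p})e_v=0$. Solutions are absolutely continuous functions satisfying the differential equations almost everywhere. Fast finite-time stability: a system $\dot x=F(x)$ on $\mathbb{R}^N$ with equilibrium $0$ is fast finite-time stable (FFTS) at the origin if the origin is Lyapunov stable and there exist a continuous positive definite function $V$ on $\mathbb{R}^N$ and constants $\lambda_1,\lambda_2>0$, $\alpha\in(0,1)$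 such that every solution with initial value $x_0$ reaches the origin, and remains there, within a settling time $$T\le\frac{1}{\lambda_1(1-\alpha)}\ln\frac{\lambda_1V^{1-\alpha}(x_0)+\lambda_2}{\lambda_2}.$$ *)

(* Defs.v *)
From mathcomp Require Import all_boot all_order all_algebra.
From mathcomp Require Import all_classical all_reals all_analysis.
From mathcomp Require Import complex.

Set Implicit Arguments.
Unset Strict Implicit.
Unset Printing Implicit Defensive.

Import Order.TTheory GRing.Theory Num.Theory.
Import numFieldNormedType.Exports.

Local Open Scope classical_set_scope.
Local Open Scope ring_scope.

Definition hurwitz (R : realType) (n : nat) (A : 'M[R]_n) : Prop :=
  forall z : R[i]%C,
    eigenvalue (map_mx (real_complex R) A) z -> complex.Re z < 0.

Definition absolutely_continuous (R : realType) (V : normedModType R)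
    (x : R -> V) (a b : R) : Prop :=
  forall eps : R, 0 < eps ->
  exists2 delta : R, 0 < delta &
  forall (n : nat) (l r : 'I_n -> R),
    (forall i, a <= l i /\ l i <= r i /\ r i <= b) ->
    trivIset [set: 'I_n] (fun i => `]l i, r i[%classic) ->
    \sum_(i < n) (r i - l i) < delta ->
    \sum_(i < n) `|x (r i) - x (l i)| < eps.

Definition locally_ac (R : realType) (V : normedModType R)
    (x : R -> V) (tau : \bar R) : Prop :=
  forall a b : R, 0 <= a -> a <= b -> (b%:E < tau)%E ->
    absolutely_continuous x a b.

Definition ae_before (R : realType) (tau : \bar R) (P : R -> Prop) : Prop :=
  {ae (@lebesgue_measure R), forall t : R, 0 <= t -> (t%:E < tau)%E -> P t}.

(* Solutions live on [0, tau[, with tau = +oo allowed; tau need not be the end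
   of a maximal interval of existence. *)
Definition solution (R : realType) (N : nat) (F : 'cV[R]_N -> 'cV[R]_N)
    (tau : \bar R) (x : R -> 'cV[R]_N) : Prop :=
  [/\ (0 < tau)%E, locally_ac x tau
    & ae_before tau (fun t => derivable x t 1 /\ x^`()%classic t = F (x t))].

(* `|_| is the sup norm; stability does not depend on the choice of the norm. *)
Definition lyapunov_stable (R : realType) (N : nat)
    (F : 'cV[R]_N -> 'cV[R]_N) : Prop :=
  forall eps : R, 0 < eps ->
  exists2 delta : R, 0 < delta &
  forall (tau : \bar R) (x : R -> 'cV[R]_N), solution F tau x ->
    `|x 0| < delta ->
    forall t : R, 0 <= t -> (t%:E < tau)%E -> `|x t| < eps.

Definition positive_definite (R : realType) (N : nat)
    (V : 'cV[R]_N -> R) : Prop :=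
  V 0 = 0 /\ forall x, x != 0 -> 0 < V x.

(* The last clause is about every solution, including those given on a bounded
   interval only: none escapes to infinity in finite time, and each of them
   vanishes from a time T within the bound on, for as long as it is defined.
   For tau = +oo this says that the origin is reached at T and never left. *)
Definition fast_finite_time_stable (R : realType) (N : nat)
    (F : 'cV[R]_N -> 'cV[R]_N) : Prop :=
  [/\ F 0 = 0, lyapunov_stable F &
  exists (V : 'cV[R]_N -> R) (lambda1 lambda2 alpha : R),
    [/\ continuous V, positive_definite V,
        0 < lambda1 /\ 0 < lambda2, 0 < alpha < 1 &
    forall (tau : \bar R) (x : R -> 'cV[R]_N), solution F tau x ->
      ((tau < +oo)%E -> exists M : R,
         forall t : R, 0 <= t -> (t%:E < tau)%E -> `|x t| <= M) /\
      exists T : R,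
        [/\ 0 <= T,
            T <= 1 / (lambda1 * (1 - alpha)) *
                 ln ((lambda1 * V (x 0) `^ (1 - alpha) + lambda2) / lambda2)
          & forall t : R, T <= t -> (t%:E < tau)%E -> x t = 0]]].

(* x^T x as a scalar.  Below it is raised to negative powers: since 0 `^ r = 0
   for r != 0 and 0^-1 = 0, phi1 and phi2 vanish at 0, and so do, at eb = 0,
   the products (eb^T eb)^((1-p)/p) eb and (eb^T eb)^((1-p)/p) H(eb, _) ev. *)
Definition sqn (R : realType) (x : 'cV[R]_3) : R := (x^T *m x) 0 0.

Definition phi1 (R : realType) (p k : R) (x : 'cV[R]_3) : 'cV[R]_3 :=
  k *: x + sqn x `^ ((1 - p) / (3 * p - 2)) *: x.

Definition phi2 (R : realType) (p k : R) (x : 'cV[R]_3) : 'cV[R]_3 :=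
  k ^+ 2 *: x
  + (2 * k * (2 * p - 1) / (3 * p - 2) *
     sqn x `^ ((1 - p) / (3 * p - 2))) *: x
  + (p / (3 * p - 2) * sqn x `^ (2 * (1 - p) / (3 * p - 2))) *: x.

Definition Hmx (R : realType) (x : 'cV[R]_3) (k : R) : 'M[R]_3 :=
  1%:M - (2 * k / sqn x) *: (x *m x^T).

Definition psi_t (R : realType) (p kappa : R) (eb ev : 'cV[R]_3) : 'cV[R]_3 :=
  ev + kappa *: (eb + sqn eb `^ ((1 - p) / p) *: eb).

Definition H_term (R : realType) (p : R) (eb ev : 'cV[R]_3) : 'cV[R]_3 :=
  sqn eb `^ ((1 - p) / p) *: (Hmx eb ((p - 1) / p) *m ev) + ev.

Definition A_t (R : realType) (k1 k2 : R) : 'M[R]_(1 + 1) :=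
  block_mx (- k1)%:M 1%:M
           (- k2)%:M 0.

Definition e3 (R : realType) : 'cV[R]_3 := delta_mx ord_max 0.

Definition SO3 (R : realType) (Q : 'M[R]_3) : Prop :=
  Q^T *m Q = 1%:M /\ \det Q = 1.

Definition translational_motion (R : realType) (m g : R) (tau : \bar R)
    (f : R -> R) (Rot : R -> 'M[R]_3) (phiD b v : R -> 'cV[R]_3) : Prop :=
  [/\ locally_ac b tau, locally_ac v tau &
  ae_before tau (fun t =>
    [/\ derivable b t 1, derivable v t 1,
        b^`()%classic t = v t &
        m *: v^`()%classic t
        = (m * g) *: e3 R - f t *: (Rot t *m e3 R) + phiD t])].

Definition extended_state_observer (R : realType)
    (p m g k1 k2 k3 kappa : R) (tau : \bar R)
    (f : R -> R) (Rot : R -> 'M[R]_3)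
    (b v bh vh phih : R -> 'cV[R]_3) : Prop :=
  [/\ locally_ac bh tau, locally_ac vh tau, locally_ac phih tau &
  ae_before tau (fun t =>
    let eb := b t - bh t in
    let ev := v t - vh t in
    let psi := psi_t p kappa eb ev in
    [/\ derivable bh t 1 /\ derivable vh t 1 /\ derivable phih t 1,
        bh^`()%classic t = vh t,
        m *: vh^`()%classic t
        = (m * g) *: e3 R - f t *: (Rot t *m e3 R)
          + (m * k1) *: phi1 p k3 psi
          + (m * kappa) *: H_term p eb ev
          + phih t &
        phih^`()%classic t = (m * k2) *: phi2 p k3 psi])].

Definition error_dynamics (R : realType) (p m k1 k2 k3 kappa : R)
    (tau : \bar R) (phiD eb ev ephi : R -> 'cV[R]_3) : Prop :=
  [/\ locally_ac eb tau, locally_ac ev tau, locally_ac ephi tau &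
  ae_before tau (fun t =>
    let psi := psi_t p kappa (eb t) (ev t) in
    [/\ derivable eb t 1 /\ derivable ev t 1 /\ derivable ephi t 1,
        eb^`()%classic t = ev t,
        m *: ev^`()%classic t
        = - ((m * k1) *: phi1 p k3 psi)
          - (m * kappa) *: H_term p (eb t) (ev t)
          + ephi t &
        ephi^`()%classic t
        = - ((m * k2) *: phi2 p k3 psi) + phiD^`()%classic t])].

(* The right-hand side of [error_dynamics] when the derivative of phiD is 0, on
   R^9 with coordinates (eb, ev, ephi); the second equation is divided by m. *)
Definition error_field (R : realType) (p m k1 k2 k3 kappa : R)
    (e : 'cV[R]_(3 + (3 + 3))) : 'cV[R]_(3 + (3 + 3)) :=
  let eb := usubmx e in
  let ev := usubmx (dsubmx e) in
  let ephi := dsubmx (dsubmx e) in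
  let psi := psi_t p kappa eb ev in
  col_mx ev
 (col_mx (m^-1 *: (- ((m * k1) *: phi1 p k3 psi)
                   - (m * kappa) *: H_term p eb ev
                   + ephi))
         (- ((m * k2) *: phi2 p k3 psi))).

(* Main.v *)
Require Import Defs.
From mathcomp Require Import all_boot all_order all_algebra.
From mathcomp Require Import all_classical all_reals all_analysis.
From mathcomp Require Import measurable_realfun ring lra.
Set Implicit Arguments.
Unset Strict Implicit.
Unset Printing Implicit Defensive.
Import Order.TTheory GRing.Theory Num.Theory.
Import numFieldNormedType.Exports.
Local Open Scope classical_set_scope.
Local Open Scope ring_scope.

(* Write b = (1-p)/p, c = (1-p)/(3p-2), z = e_phi/m.  Since H comes from the
   differential of |x|^(2b) x, away from e_b = 0 the errors satisfy
     psi' = - kt1 phi1(psi) + z,   z' = - kt2 phi2(psi),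
     e_b' = psi - kappat (e_b + |e_b|^(2b) e_b).
   As phi2 = (D phi1) phi1, an explicit quadratic form V1 in (phi1(psi), z)
   decays like - (V1 + V1^(1/p)), and V = mu V1 + |e_b|^2 satisfies
   V' <= - (lambda1 V + lambda2 V^(1/p)).  Integrating this inequality makes
   T(V) + t nonincreasing, T(V) being the claimed settling time.
   (V1, V and T are [lyap_reach], [lyap] and [settling] below.)

   The regularity of V along a solution is the delicate point: the field is
   singular at e_b = 0, and phi1 is not Lipschitz at 0.  An absolutely continuous
   function with almost everywhere a continuous derivative is differentiable,
   so e_b and z are C^1, and e_v is C^1 where e_b <> 0.  A continuous function
   that is nonincreasing immediately to the right of every point is
   nonincreasing, so it is enough to look at right neighbourhoods.  If
   psi <> 0 at r, then e_b <> 0 and psi <> 0 just after r, as e_b has nonzero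
   derivative e_v = psi when it vanishes.  If psi = 0 and z <> 0 at r, then
   psi . z(r) becomes positive after r.  If psi = z = 0 at r, then V1 = 0 from
   then on, and V = |e_b|^2 is C^1. *)

(** * Absolutely continuous functions *)

Section AlmostEverywhere.
Context {R : realType}.
Let aeF := @ae_filter_ringOfSetsType _ _ _ (@lebesgue_measure R).

Lemma ae_imp (P Q : R -> Prop) : {ae @lebesgue_measure R, forall t, P t} ->
  (forall t, P t -> Q t) -> {ae @lebesgue_measure R, forall t, Q t}.
Proof. by move=> H PQ; have F := aeF; move: H; apply: filterS. Qed.

Lemma ae_and (P Q : R -> Prop) : {ae @lebesgue_measure R, forall t, P t} ->
  {ae @lebesgue_measure R, forall t, Q t} ->
  {ae @lebesgue_measure R, forall t, P t /\ Q t}.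
Proof. by move=> HP HQ; have F := aeF; exact: filterI. Qed.

End AlmostEverywhere.

Lemma near_ball (R : realType) (P : R -> Prop) (x : R) :
  (\forall y \near x, P y) -> exists2 d, 0 < d & forall y, `|y - x| < d -> P y.
Proof.
move=> /nbhs_ballP[d d0 h]; exists d => // y yx.
by apply: h; rewrite /ball /= distrC.
Qed.

(** Cousin's lemma in relational form. The supremum of the points reachable from a is itself
    reachable, since the gauge at that point spans it; if it lay below b, the same gauge would carry
    reachability past it. *)
Lemma cousin (R : realType) (Rel : R -> R -> Prop) (a b : R) :
  a <= b ->
  (forall s t u, s <= t -> t <= u -> Rel s t -> Rel t u -> Rel s u) ->
  (forall c, a <= c -> c <= b -> exists2 d, 0 < d &
    forall s t, a <= s -> s <= c -> c <= t -> t <= b ->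
      c - s < d -> t - c < d -> Rel s t) ->
  Rel a b.
Proof.
move=> ab tr gauge.
pose S := [set t | a <= t /\ t <= b /\ Rel a t].
have Sa : S a.
  have [d d0 h] := gauge a (lexx _) ab.
  by do 2?split => //; apply: h => //; rewrite subrr.
have Sb : has_sup S by split; [exists a | exists b => t [_ []]].
have Sub := sup_upper_bound Sb.
have ac : a <= sup S by exact: Sub.
have cb : sup S <= b by apply: ge_sup; [exists a | move=> t [_ []]].
have [d d0 h] := gauge _ ac cb.
have [t [at_ [tb Rt]] ht] := sup_adherent d0 Sb.
have tc : t <= sup S by exact: Sub.
have d2 : 0 < d / 2 by rewrite divr_gt0.
pose c' := Num.min b (sup S + d / 2).
have cc' : sup S <= c' by rewrite le_min cb ler_wpDr // ltW.
have c'b : c' <= b by rewrite ge_min lexx.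
have c'd : c' - sup S < d.
  have : c' <= sup S + d / 2 by rewrite ge_min lexx orbT.
  by lra.
have Rac' : Rel a c'.
  apply: (tr _ t) => //; first exact: le_trans cc'.
  by apply: h => //; lra.
have : c' <= sup S by apply: Sub; split; [exact: le_trans cc' | split].
rewrite /c' ge_min => /orP[bc | ].
  by have -> : b = c' by apply/eqP; rewrite eq_le c'b (le_trans bc cc').
by lra.
Qed.

Section AbsolutelyContinuous.
Context {R : realType}.
Implicit Types (L : seq (R * R)) (U : set R).
Local Notation mu := (@lebesgue_measure R).

(** Listing the intervals from left to right makes disjointness a consequence of the order, and
    concatenation then matches the transitivity asked by [cousin]. *)
Fixpoint chain U (s : R) L (t : R) : Prop :=
  if L is (l, r) :: L' then
    [/\ s <= l, l <= r, `]l, r[ `<=` U & chain U r L' t]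
  else s <= t.

Lemma chain_le U L s t : chain U s L t -> s <= t.
Proof.
elim: L s => [//|[l r] L IH] s /= [sl lr _ /IH rt].
exact: le_trans sl (le_trans lr rt).
Qed.

Lemma chainW U L s s' t : s' <= s -> chain U s L t -> chain U s' L t.
Proof.
case: L => [|[l r] L] ss' /=; first exact: le_trans.
by case=> sl lr lU rt; split => //; exact: le_trans sl.
Qed.

Lemma chain_cat U L L' s t u :
  chain U s L t -> chain U t L' u -> chain U s (L ++ L') u.
Proof.
elim: L s => [|[l r] L IH] s /=; first by move=> st; exact: chainW.
by case=> sl lr lU rt tu; split => //; exact: IH.
Qed.

Lemma chain_nth U L s t i : (i < size L)%N -> chain U s L t ->
  [/\ s <= (nth (0, 0) L i).1, (nth (0, 0) L i).1 <= (nth (0, 0) L i).2,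
      (nth (0, 0) L i).2 <= t & `](nth (0, 0) L i).1, (nth (0, 0) L i).2[ `<=` U].
Proof.
elim: L s i => [//|[l r] L IH] s [|i] /= iL [sl lr lU rt].
  by split => //; exact: chain_le rt.
have [h1 h2 h3 h4] := IH _ _ iL rt; split => //.
exact: le_trans sl (le_trans lr h1).
Qed.

Lemma chain_nth2 U L s t i j : (i < j < size L)%N -> chain U s L t ->
  (nth (0, 0) L i).2 <= (nth (0, 0) L j).1.
Proof.
elim: L s i j => [s i j|[l r] L IH s [|i] [|j]] //=.
- by rewrite ltn0 andbF.
- by move=> jL [sl lr lU /(chain_nth jL)[]].
- by move=> iL [sl lr lU /IH]; exact.
Qed.

Lemma chain_triv U L s t : chain U s L t ->
  trivIset [set: 'I_(size L)]
    (fun i => `](nth (0, 0) L i).1, (nth (0, 0) L i).2[%classic).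
Proof.
move=> cL; apply/trivIsetP => i j _ _ ij.
wlog ltij : i j ij / (i < j)%N.
  move=> H; have [] := ltngtP i j => [| |ij']; first exact: H.
    by rewrite setIC; apply: H; rewrite eq_sym.
  by move: ij; rewrite -val_eqE /= ij' eqxx.
have h : (nth (0, 0) L i).2 <= (nth (0, 0) L j).1.
  by apply: chain_nth2 cL; rewrite ltij ltn_ord.
rewrite -subset0 => x [] /=; rewrite !in_itv /= => /andP[_ xi] /andP[jx _].
by have := lt_le_trans (lt_trans jx xi) h; rewrite ltxx.
Qed.

(** The intervals are pairwise disjoint, so additivity turns the sum of their lengths into the
    measure of a union contained in U. *)
Lemma chain_measure U L s t : open U -> chain U s L t ->
  ((\sum_(i < size L) ((nth (0, 0) L i).2 - (nth (0, 0) L i).1)%R)%:E <= mu U)%E.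
Proof.
move=> oU cL.
pose F (i : 'I_(size L)) : set R :=
  `](nth (0, 0) L i).1, (nth (0, 0) L i).2[%classic.
have mF i : mu (F i) = ((nth (0, 0) L i).2 - (nth (0, 0) L i).1)%:E.
  rewrite /F lebesgue_measure_itv /= lte_fin.
  have [_ h _ _] := chain_nth (ltn_ord i) cL.
  case: ltP => // h'.
  have -> : (nth (0, 0) L i).2 = (nth (0, 0) L i).1.
    by apply/eqP; rewrite eq_le h h'.
  by rewrite subrr.
rewrite -sumEFin -(eq_bigr _ (fun i _ => mF i)).
rewrite -measure_bigsetU_ord //; last exact: chain_triv cL.
apply: le_measure; rewrite ?inE.
- by apply: bigsetU_measurable => i _; exact: measurable_itv.
- exact: open_measurable.
- apply: (big_ind (fun A => A `<=` U)) => //.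
  + by move=> A B AU BU x [/AU|/BU].
  + by move=> i _; have [] := chain_nth (ltn_ord i) cL.
- by move=> i; exact: measurable_itv.
Qed.

(* Off the exceptional set the slope of y is locally less than e; an interval
   tagged in the exceptional set lies in an open set of small measure, where
   absolute continuity bounds the total variation of y. *)
Lemma ac_ae_nonincreasing (y : R -> R) (a b : R) : a <= b ->
  absolutely_continuous y a b ->
  {ae mu, forall t, a < t -> t < b -> derivable y t 1 /\ y^`()%classic t <= 0} ->
  y b <= y a.
Proof.
move=> ab acy aey.
(* The term in b - a pays for the slopes at regular points, the last term for the variation over
   exceptional intervals. *)
suff H (e : R) : 0 < e -> y b - y a <= e * (b - a) + e.
  apply/ler_addgt0Pr => e e0.
  have k0 : 0 < b - a + 1 by lra.
  have := H (e / (b - a + 1)) (divr_gt0 e0 k0).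
  have -> : e / (b - a + 1) * (b - a) + e / (b - a + 1) = e.
    by field; rewrite gt_eqF.
  by lra.
move=> e0.
have [d d0 acd] := acy e e0.
case: aey => A [mA A0 sA].
(* The hypothesis says nothing at the two endpoints, so they join the exceptional set, which stays
   null. *)
pose B := A `|` [set a] `|` [set b].
have m1 c : measurable [set c : R] by exact: measurable_set1.
have mAa : measurable (A `|` [set a]) by exact: measurableU.
have mB : measurable B by exact: measurableU.
have B0 : mu B = 0%E.
  rewrite [LHS]measureU0 //; last exact: lebesgue_measure_set1.
  by rewrite [LHS]measureU0 //; last exact: lebesgue_measure_set1.
have [U [oU BU mUB]] : exists U : set R,
    [/\ open U , B `<=` U & (mu (U `\` B) < d%:E)%E].
  apply: lebesgue_regularity_outer d0 => //.
  by apply: (@le_lt_trans _ _ 0%E); [rewrite le_eqVlt; apply/orP; left; exact/eqP/B0 | exact: ltry].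
have mUd : (mu U < d%:E)%E.
  have mU : measurable U by exact: open_measurable.
  apply: le_lt_trans mUB.
  have <- : mu ((U `\` B) `|` B) = mu (U `\` B).
    by apply: measureU0 => //; exact: measurableD.
  by rewrite setUC setDUK.
pose Rel s t := exists2 L, chain U s L t &
  y t - y s <= e * (t - s) + \sum_(i < size L)
    `|y (nth (0, 0) L i).2 - y (nth (0, 0) L i).1|.
have : Rel a b.
  apply: cousin => //.
  - move=> s t u st tu [L cL hL] [L' cL' hL']; exists (L ++ L').
      exact: chain_cat cL'.
    rewrite size_cat big_split_ord /=.
    under eq_bigr do rewrite nth_cat ltn_ord.
    under [X in _ + (_ + X)]eq_bigr do rewrite nth_cat ltnNge leq_addr /= addKn.
    by lra.
  move=> c ac cb.
  have [/BU Uc|nBc] := pselect (B c).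
    have /near_ball[r r0 hr] : \forall x \near c, U x by exact: open_nbhs_nbhs.
    exists r => // s t _ sc ct _ cs tc.
    have st := le_trans sc ct.
    exists [:: (s, t)].
      split => //= x /=; rewrite in_itv /= => /andP[sx xt]; apply: hr.
      by rewrite ltr_norml; apply/andP; split; lra.
    rewrite big_ord_recl big_ord0 /= addr0.
    have := ler_norm (y t - y s).
    by have : 0 <= e * (t - s) by [apply: mulr_ge0; lra]; lra.
  have {nBc}[nA [ca cb']] : ~ A c /\ c <> a /\ c <> b.
    by split=> [?|]; [|split=> ?]; apply: nBc; rewrite /B /=; tauto.
  have aLc : a < c by rewrite lt_neqAle ac andbT eq_sym; apply/eqP.
  have cLb : c < b by rewrite lt_neqAle cb andbT; apply/eqP.
  have [dc dc0] : derivable y c 1 /\ y^`()%classic c <= 0.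
    apply: contrapT => nd; apply: nA; apply: sA => /= h; apply: nd.
    exact: h.
  have /cvgrPdist_lt/(_ e e0) : (h^-1 *: (y (h + c) - y c)) @[h --> 0^'] --> y^`()%classic c.
    by rewrite derive1E; move: dc; rewrite /derivable /derive /=;
      under eq_fun do rewrite scaler1.
  rewrite near_withinE => /near_ball[r r0 hr].
  have slope h : `|h| < r -> h != 0 -> h^-1 * (y (h + c) - y c) < e.
    move=> hlt h0; have := hr h; rewrite subr0 => /(_ hlt h0).
    by rewrite ltr_norml => /andP[+ _]; rewrite /GRing.scale /=; lra.
  exists r => // s t _ sc ct _ cs tc; exists [::].
    exact: le_trans ct.
  rewrite big_ord0 addr0.
  have h1 : y t - y c <= e * (t - c).
    have [->|ne] := eqVneq t c; first by rewrite !subrr mulr0.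
    have tc0 : 0 < t - c by rewrite subr_gt0 lt_neqAle eq_sym ne.
    have := slope (t - c); rewrite subrK gt_eqF // gtr0_norm //.
    by move=> /(_ tc isT)/ltW; rewrite mulrC ler_pdivrMr.
  have h2 : y c - y s <= e * (c - s).
    have [->|ne] := eqVneq s c; first by rewrite !subrr mulr0.
    have tc0 : 0 < c - s by rewrite subr_gt0 lt_neqAle ne.
    have sc0 : s - c < 0 by lra.
    have := slope (s - c); rewrite subrK (lt_eqF sc0) (ltr0_norm sc0) opprB.
    move=> /(_ cs isT)/ltW.
    rewrite -opprB invrN mulNr -mulrN opprB mulrC.
    by rewrite ler_pdivrMr.
  by lra.
case=> L cL /le_trans; apply; rewrite lerD2l ltW //.
apply: (acd _ (fun i => (nth (0, 0) L i).1) (fun i => (nth (0, 0) L i).2)).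
- by move=> i; have [] := chain_nth (ltn_ord i) cL.
- exact: chain_triv cL.
- by rewrite -lte_fin (le_lt_trans _ mUd) // (chain_measure oU cL).
Qed.

End AbsolutelyContinuous.

Lemma cts_ball (R : realType) (f : R -> R) (x e : R) :
  {for x, continuous f} -> 0 < e ->
  exists2 d, 0 < d & forall y, `|y - x| < d -> `|f y - f x| < e.
Proof.
move=> /cvgrPdist_lt cf e0; have [d d0 h] := near_ball (cf e e0).
by exists d => // y /h; rewrite distrC.
Qed.

Lemma is_derive_eps (R : realType) (f : R -> R) (x l : R) :
  (forall e, 0 < e -> exists2 d, 0 < d & forall h, `|h| < d ->
    `|f (h + x) - f x - l * h| <= e * `|h|) ->
  is_derive x 1 f l.
Proof.
move=> H.
have cv : (h^-1 *: (f (h *: 1 + x) - f x)) @[h --> 0^'] --> (l : R^o).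
  apply/cvgrPdist_le => e e0; have [d d0 hd] := H e e0.
  rewrite near_withinE; apply/nbhs_ballP; exists d => // h.
  rewrite /ball /= sub0r normrN => hlt h0.
  have := hd h hlt; rewrite /GRing.scale /= mulr1.
  have -> : f (h + x) - f x - l * h = - (l - h^-1 * (f (h + x) - f x)) * h.
    by field.
  by rewrite normrM normrN ler_pM2r ?normr_gt0.
by split; [apply/cvg_ex; exists l | exact/cvg_lim].
Qed.

Section AbsolutelyContinuousDerivative.
Context {R : realType}.
Local Notation mu := (@lebesgue_measure R).

Lemma acW (V : normedModType R) (y : R -> V) a b a' b' : a <= a' -> b' <= b ->
  absolutely_continuous y a b -> absolutely_continuous y a' b'.
Proof.
move=> aa bb acy e e0; have [d d0 hd] := acy e e0; exists d => // n l r lr.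
apply: hd => i; have [h1 [h2 h3]] := lr i.
by split; [exact: le_trans h1 | split => //; exact: le_trans bb].
Qed.

Lemma ac_affine (y : R -> R) a b c k : absolutely_continuous y a b ->
  absolutely_continuous (fun t => c * y t + k * t) a b.
Proof.
move=> acy e e0.
have c0 : 0 < `|c| + 1 by rewrite ltr_wpDl.
have k0 : 0 < `|k| + 1 by rewrite ltr_wpDl.
have e1 : 0 < e / 2 / (`|c| + 1) by rewrite !divr_gt0.
have e2 : 0 < e / 2 / (`|k| + 1) by rewrite !divr_gt0.
have [d d0 hd] := acy _ e1.
exists (Num.min d (e / 2 / (`|k| + 1))); first by rewrite lt_min d0.
move=> n l r lr tlr; rewrite lt_min => /andP[s1 s2].
have := hd n l r lr tlr s1.
rewrite ltr_pdivlMr // mulrC => s1'.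
move: s2; rewrite ltr_pdivlMr // mulrC => s2'.
apply: (@le_lt_trans _ _ ((`|c| + 1) * \sum_(i < n) `|y (r i) - y (l i)|
  + (`|k| + 1) * \sum_(i < n) (r i - l i))); last by lra.
rewrite !mulr_sumr -big_split /=; apply: ler_sum => i _.
have [_ [lri _]] := lr i.
have -> : c * y (r i) + k * r i - (c * y (l i) + k * l i) =
  c * (y (r i) - y (l i)) + k * (r i - l i) by ring.
apply: (le_trans (ler_normD _ _)); rewrite !normrM.
rewrite (ger0_norm (_ : 0 <= r i - l i)) ?subr_ge0 //.
by rewrite lerD // ler_wpM2r ?normr_ge0 ?subr_ge0 // lerDl.
Qed.

(** Subtracting the line k t reduces a bound on the slope to monotonicity. *)
Lemma ac_ae_le (y : R -> R) (a b k : R) : a <= b ->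
  absolutely_continuous y a b ->
  {ae mu, forall t, a < t -> t < b ->
    derivable y t 1 /\ y^`()%classic t <= k} ->
  y b - y a <= k * (b - a).
Proof.
move=> ab acy aey.
have := @ac_ae_nonincreasing R (fun t => 1 * y t + (- k) * t) a b ab.
move=> /(_ (ac_affine 1 (- k) acy)) H.
suff : 1 * y b + - k * b <= 1 * y a + - k * a by lra.
apply: H; apply: (ae_imp aey) => t h at_ tb.
have [dy yk] := h at_ tb.
have D : is_derive t 1 (fun t => 1 * y t + (- k) * t) (y^`()%classic t - k).
  have Dy : is_derive t 1 y (y^`()%classic t) by rewrite derive1E; exact/derivableP.
  by apply: is_derive_eq; rewrite /GRing.scale /=; ring.
split; first exact: ex_derive.
by rewrite derive1E derive_val; lra.
Qed.

Lemma ac_ae_ge (y : R -> R) (a b k : R) : a <= b ->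
  absolutely_continuous y a b ->
  {ae mu, forall t, a < t -> t < b ->
    derivable y t 1 /\ k <= y^`()%classic t} ->
  k * (b - a) <= y b - y a.
Proof.
move=> ab acy aey.
have := @ac_ae_nonincreasing R (fun t => (-1) * y t + k * t) a b ab.
move=> /(_ (ac_affine (-1) k acy)) H.
suff : -1 * y b + k * b <= -1 * y a + k * a by lra.
apply: H; apply: (ae_imp aey) => t h at_ tb.
have [dy yk] := h at_ tb.
have D : is_derive t 1 (fun t => (-1) * y t + k * t) (k - y^`()%classic t).
  have Dy : is_derive t 1 y (y^`()%classic t) by rewrite derive1E; exact/derivableP.
  by apply: is_derive_eq; rewrite /GRing.scale /=; ring.
split; first exact: ex_derive.
by rewrite derive1E derive_val; lra.
Qed.

(** Close to s the almost everywhere derivative is within e of Phi s, so the two slope bounds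
    squeeze every increment of y between (Phi s - e) and (Phi s + e) times its length. Continuity of
    Phi is used at s only, which matters for a singular field. *)
Lemma ac_ae_is_derive (y Phi : R -> R) (a b s : R) : a < s -> s < b ->
  absolutely_continuous y a b ->
  {ae mu, forall t, a < t -> t < b ->
    derivable y t 1 /\ y^`()%classic t = Phi t} ->
  {for s, continuous Phi} ->
  is_derive s 1 y (Phi s).
Proof.
move=> as_ sb acy aey cP; apply: is_derive_eps => e e0.
have [d1 d10 hd1] := cts_ball cP e0.
pose d := Num.min d1 (Num.min (s - a) (b - s)).
have [dd1 [da db]] : d <= d1 /\ d <= s - a /\ d <= b - s.
  by rewrite /d; split; [|split]; rewrite !ge_min !lexx ?orbT.
have d0 : 0 < d by rewrite !lt_min d10 !subr_gt0 as_.
have key u v : u <= v -> s - d < u -> v < s + d ->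
   (Phi s - e) * (v - u) <= y v - y u <= (Phi s + e) * (v - u).
  move=> uv su vs.
  have acuv : absolutely_continuous y u v by apply: acW acy; lra.
  have near_t t : u < t -> t < v -> `|Phi t - Phi s| < e.
    by move=> ut tv; apply: hd1; rewrite ltr_norml; apply/andP; split; lra.
  apply/andP; split; [apply: ac_ae_ge|apply: ac_ae_le] => //;
    apply: (ae_imp aey) => t h ut tv;
    have := near_t t ut tv; rewrite ltr_norml => /andP[h1 h2];
    (have [dy ->] : derivable y t 1 /\ y^`()%classic t = Phi t by apply: h; lra);
    by split => //; lra.
exists d => // h; rewrite ltr_norml => /andP[h1 h2].
have [h0|h0] := leP 0 h.
  have /andP[k1 k2] : (Phi s - e) * (h + s - s) <= y (h + s) - y s
      <= (Phi s + e) * (h + s - s) by apply: key; lra.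
  by rewrite (ger0_norm h0) ler_norml; apply/andP; split; lra.
have /andP[k1 k2] : (Phi s - e) * (s - (h + s)) <= y s - y (h + s)
      <= (Phi s + e) * (s - (h + s)) by apply: key; lra.
by rewrite (ltr0_norm h0) ler_norml; apply/andP; split; lra.
Qed.

End AbsolutelyContinuousDerivative.

(** * Monotonicity from right neighbourhoods *)

Section RightNonincreasing.
Context {R : realType}.
Implicit Types u w : R -> R.

(** Values are compared with u r alone and only after r, so no differentiability is involved and the
    left of r, where the trajectory may be singular, does not matter. *)
Definition right_nonincreasing u r :=
  exists2 d, 0 < d & forall s, r <= s -> s < r + d -> u s <= u r.

Lemma right_limit_le u r k d : {for r, continuous u} -> 0 < d ->
  (forall s, r < s -> s < r + d -> k <= u s) -> k <= u r.
Proof.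
move=> cu d0 h; rewrite leNgt; apply/negP => uk.
have e0 : 0 < k - u r by rewrite subr_gt0.
have [d1 d10 hd1] := cts_ball cu e0.
pose m := Num.min d d1 / 2.
have [m0 [md md1]] : 0 < m /\ m < d /\ m < d1.
  have h0 : 0 < Num.min d d1 by rewrite lt_min d0.
  have h1 : Num.min d d1 <= d by rewrite ge_min lexx.
  have h2 : Num.min d d1 <= d1 by rewrite ge_min lexx orbT.
  by rewrite /m; lra.
have k1 : k <= u (r + m) by apply: h; lra.
have := hd1 (r + m); rewrite addrAC subrr add0r gtr0_norm // => /(_ md1).
by rewrite ltr_norml => /andP[_]; lra.
Qed.

(** By continuity the supremum of the sublevel set belongs to it. *)
Lemma last_sublevel u a b : a <= b -> continuous u ->
  exists c, [/\ a <= c, c <= b, u c <= u a &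
    forall t, c < t -> t <= b -> u a < u t].
Proof.
move=> ab cu; pose S := [set t | a <= t /\ t <= b /\ u t <= u a].
have Sa : S a by split.
have Sb : has_sup S by split; [exists a | exists b => t [_ []]].
have Sub := sup_upper_bound Sb.
have ac : a <= sup S by exact: Sub.
exists (sup S); split => //.
- by apply: ge_sup; [exists a | move=> t [_ []]].
- rewrite leNgt; apply/negP => uk.
  have e0 : 0 < u (sup S) - u a by rewrite subr_gt0.
  have [d d0 hd] := cts_ball (cu (sup S)) e0.
  have [t [at_ [tb ut]] ht] := sup_adherent d0 Sb.
  have tc : t <= sup S by exact: Sub.
  have := hd t; rewrite ler0_norm ?subr_le0 // opprB => /(_ ltac:(lra)).
  by rewrite ltr_norml => /andP[]; lra.
- move=> t ct tb; rewrite ltNge; apply/negP => ut.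
  have : S t by split; [lra | split].
  by move=> /Sub; lra.
Qed.

(** At the last point of the sublevel set of u a, the local condition would give further points of
    that set unless b has been reached. Hence the condition is only needed where u does not exceed u
    a. *)
Lemma right_nonincreasing_le u a b : a <= b -> continuous u ->
  (forall r, a <= r -> r < b -> u r <= u a -> right_nonincreasing u r) ->
  u b <= u a.
Proof.
move=> ab cu H; have [c [ac cb uc hc]] := last_sublevel ab cu.
move: cb; rewrite le_eqVlt => /orP[/eqP <- //|cb].
have [d d0 hd] := H _ ac cb uc.
pose k := Num.min (d / 2) (b - c).
have [k0 [kd kb]] : 0 < k /\ k <= d / 2 /\ k <= b - c.
  rewrite /k; split; last by rewrite !ge_min !lexx orbT.
  by rewrite lt_min subr_gt0 cb divr_gt0.
have h1 : u (c + k) <= u c by apply: hd; lra.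
have h2 : u a < u (c + k) by apply: hc; lra.
by have := lt_le_trans h2 (le_trans h1 uc); rewrite ltxx.
Qed.

(** Variant for a condition known only above the level u a, typically where a nonnegative function
    is positive. After the last point c of the sublevel set all values are above that level, so u b
    <= u s for every s in between, and s tends to c. *)
Lemma right_nonincreasing_le_gt u a b : a <= b -> continuous u ->
  (forall r, a < r -> r < b -> u a < u r -> right_nonincreasing u r) ->
  u b <= u a.
Proof.
move=> ab cu H; have [c [ac cb uc hc]] := last_sublevel ab cu.
move: cb; rewrite le_eqVlt => /orP[/eqP <- //|cb].
have d0 : 0 < b - c by rewrite subr_gt0.
apply: le_trans uc; apply: (right_limit_le (cu _) d0).
move=> s cs sb; apply: right_nonincreasing_le => //; first by lra.
move=> r sr rb _; apply: H => //; first by lra.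
by apply: hc; lra.
Qed.

(** Adds an isolated bad point: the comparison holds from every t > r, and continuity lets t tend to
    r. *)
Lemma right_nonincreasing_of_right u r d : continuous u -> 0 < d ->
  (forall s, r < s -> s < r + d -> right_nonincreasing u s) ->
  right_nonincreasing u r.
Proof.
move=> cu d0 h; exists d => // s; rewrite le_eqVlt => /orP[/eqP -> //|rs sd].
have e0 : 0 < s - r by rewrite subr_gt0.
apply: (right_limit_le (cu _) e0).
move=> t rt ts; apply: right_nonincreasing_le => //; first by lra.
by move=> x tx xs _; apply: h; lra.
Qed.

Lemma derive_le0_nonincreasing u (a b : R) : continuous u ->
  (forall t, a < t -> t < b -> exists2 l, is_derive t 1 u l & l <= 0) ->
  forall s t, a <= s -> s <= t -> t <= b -> u t <= u s.
Proof.
move=> cu h s t as_ st tb.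
have dr x : x \in `]a, b[%R -> derivable u x 1 /\ u^`()%classic x <= 0.
  rewrite in_itv /= => /andP[ax xb]; have [l [du <-] l0] := h x ax xb.
  by rewrite derive1E.
apply: (@ler0_derive1_le_cc _ u a b) => //.
- by move=> x /dr[].
- by move=> x /dr[].
- exact: continuous_subspaceT.
- by rewrite in_itv /= (le_trans as_ st).
- by rewrite in_itv /= as_ (le_trans st tb).
Qed.

Lemma right_nonincreasing_derive u (r d : R) : continuous u -> 0 < d ->
  (forall s, r < s -> s < r + d -> exists2 l, is_derive s 1 u l & l <= 0) ->
  right_nonincreasing u r.
Proof.
move=> cu d0 h; exists d => // s rs sd.
by apply: (derive_le0_nonincreasing cu h) => //; exact: ltW.
Qed.

Lemma derive_gt0_increasing u (a b : R) : continuous u ->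
  (forall t, a < t -> t < b -> exists2 l, is_derive t 1 u l & 0 < l) ->
  forall s t, a <= s -> s < t -> t <= b -> u s < u t.
Proof.
move=> cu h s t as_ st tb.
have dr x : x \in `]a, b[%R -> derivable u x 1 /\ 0 < u^`()%classic x.
  rewrite in_itv /= => /andP[ax xb]; have [l [du <-] l0] := h x ax xb.
  by rewrite derive1E.
apply: (@gtr0_derive1_lt_cc _ u a b) => //.
- by move=> x /dr[].
- by move=> x /dr[].
- exact: continuous_subspaceT.
- by rewrite in_itv /= as_ (le_trans (ltW st) tb).
- by rewrite in_itv /= tb (le_trans as_ (ltW st)).
Qed.

(* w is first shown to be nonnegative: it can only fall where it vanishes.  A
   zero t of w is then impossible, since w is positive somewhere on the left of
   t and cannot come back to 0. *)
Lemma pos_right_of_zero w (Z : set R) r d : continuous w -> w r = 0 ->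
  (forall s, r < s -> s < r + d -> Z s -> w s = 0) ->
  (forall s, r < s -> s < r + d -> ~ Z s -> exists2 e, 0 < e &
     forall t, (s - e < t -> t < s -> w t < w s) /\
               (s < t -> t < s + e -> w s < w t)) ->
  (forall a b, r < a -> a < b -> b < r + d ->
     exists t, [/\ a < t, t < b & ~ Z t]) ->
  forall t, r < t -> t < r + d -> 0 < w t.
Proof.
move=> cw wr wZ wN noZ.
have cNw : continuous (fun t => - w t) by move=> x; exact/continuousN/cw.
have rn s : r < s -> s < r + d -> ~ Z s -> right_nonincreasing (fun t => - w t) s.
  move=> rs sd nZ; have [e e0 he] := wN s rs sd nZ; exists e => // t.
  rewrite le_eqVlt => /orP[/eqP -> //|st ts].
  by rewrite lerN2 ltW //; apply (he t).2.
have w0 t : r < t -> t < r + d -> 0 <= w t.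
  move=> rt td.
  suff : - w t <= - w r by rewrite wr; lra.
  apply: (@right_nonincreasing_le_gt (fun t => - w t)); first exact: ltW.
    exact: cNw.
  move=> s rs st; rewrite wr ltrN2 => ws; apply: rn => //; first by lra.
  by move=> /wZ; lra.
have wpos t : r < t -> t < r + d -> ~ Z t -> 0 < w t.
  move=> rt td nZ; have [e e0 he] := wN t rt td nZ.
  pose m := Num.min e (t - r) / 2.
  have [m0 [me mt]] : 0 < m /\ m < e /\ m < t - r.
    have h0 : 0 < Num.min e (t - r) by rewrite lt_min e0 subr_gt0.
    have h1 : Num.min e (t - r) <= e by rewrite ge_min lexx.
    have h2 : Num.min e (t - r) <= t - r by rewrite ge_min lexx orbT.
    by rewrite /m; lra.
  apply: (@le_lt_trans _ _ (w (t - m))); first by apply: w0; lra.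
  by apply (he (t - m)).1; lra.
move=> t rt td; have [Zt|] := pselect (Z t); last exact: wpos.
have [s [rs st nZ]] : exists s, [/\ (r + t) / 2 < s, s < t & ~ Z s].
  by apply: noZ; lra.
have rs' : r < s by lra.
have ws : 0 < w s by apply: wpos => //; lra.
suff : - w t <= - w s by rewrite (wZ t rt td Zt); lra.
apply: (@right_nonincreasing_le (fun t => - w t)); first exact: ltW.
  exact: cNw.
move=> x sx xt; rewrite lerN2 => wx; apply: rn; [lra..|].
by move=> /wZ; lra.
Qed.

End RightNonincreasing.

(** * Vectors of dimension 3 *)

Section ContinuousReal.
Context {R : realType} {T : topologicalType}.
Implicit Types f g : T -> R.

Lemma eq_continuous f g : f =1 g -> continuous f -> continuous g.
Proof. by move=> /funext ->. Qed.

Lemma ctsD f g : continuous f -> continuous g -> continuous (fun t => f t + g t).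
Proof. by move=> cf cg t; apply: continuousD; [exact: cf | exact: cg]. Qed.

Lemma ctsM f g : continuous f -> continuous g -> continuous (fun t => f t * g t).
Proof. by move=> cf cg t; apply: continuousM; [exact: cf | exact: cg]. Qed.

Lemma ctsZ a f : continuous f -> continuous (fun t => a * f t).
Proof. by apply: ctsM => t; exact: cvg_cst. Qed.

End ContinuousReal.

Section Vectors.
Context {R : realType}.
Implicit Types (x y z : 'cV[R]_3) (r : R).

Definition dot x y : R := \sum_i x i 0 * y i 0.

Lemma dotE x y : dot x y = x 0 0 * y 0 0 + x 1 0 * y 1 0 + x 2 0 * y 2 0.
Proof.
rewrite /dot !big_ord_recl big_ord0 addr0 addrA.
by congr (_ + x _ _ * y _ _ + x _ _ * y _ _); apply/val_inj.
Qed.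

Lemma sqnE x : sqn x = dot x x.
Proof. by rewrite /sqn mxE; apply: eq_bigr => i _; rewrite mxE. Qed.

Lemma dotC x y : dot x y = dot y x.
Proof. by rewrite !dotE; ring. Qed.

Lemma dotDl x y z : dot (x + y) z = dot x z + dot y z.
Proof. by rewrite !dotE !mxE; ring. Qed.

Lemma dotDr x y z : dot z (x + y) = dot z x + dot z y.
Proof. by rewrite !dotE !mxE; ring. Qed.

Lemma dotZl a x y : dot (a *: x) y = a * dot x y.
Proof. by rewrite !dotE !mxE; ring. Qed.

Lemma dotZr a x y : dot x (a *: y) = a * dot x y.
Proof. by rewrite !dotE !mxE; ring. Qed.

Lemma dot_ge0 x : 0 <= dot x x.
Proof. by apply: sumr_ge0 => i _; rewrite -expr2 sqr_ge0. Qed.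

Lemma coord_le_dot x i : x i 0 ^+ 2 <= dot x x.
Proof.
rewrite /dot (bigD1 i) //= -expr2 lerDl; apply: sumr_ge0 => j _.
by rewrite -expr2 sqr_ge0.
Qed.

Lemma dot_eq0 x : (dot x x == 0) = (x == 0).
Proof.
apply/eqP/eqP => [xx|->]; last by rewrite dotE !mxE; ring.
apply/colP => i; rewrite mxE; apply/eqP; rewrite -sqrf_eq0 eq_le sqr_ge0 andbT.
by rewrite -xx coord_le_dot.
Qed.

Lemma dot_gt0 x : x != 0 -> 0 < dot x x.
Proof. by move=> x0; rewrite lt_neqAle dot_ge0 eq_sym dot_eq0 x0. Qed.

Lemma cauchy_schwarz x y : dot x y ^+ 2 <= dot x x * dot y y.
Proof.
have -> : dot x x * dot y y = dot x y ^+ 2 + ((x 0 0 * y 1 0 - x 1 0 * y 0 0) ^+ 2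
  + (x 0 0 * y 2 0 - x 2 0 * y 0 0) ^+ 2 + (x 1 0 * y 2 0 - x 2 0 * y 1 0) ^+ 2).
  by rewrite !dotE; ring.
by rewrite lerDl !addr_ge0 // sqr_ge0.
Qed.

Lemma sqn_ge0 x : 0 <= sqn x. Proof. by rewrite sqnE dot_ge0. Qed.

Lemma sqn0 : sqn (0 : 'cV[R]_3) = 0.
Proof. by apply/eqP; rewrite sqnE dot_eq0. Qed.

Lemma sqn_gt0 x : x != 0 -> 0 < sqn x.
Proof. by rewrite sqnE; exact: dot_gt0. Qed.

(** The absolute value gives a function continuous on the whole line, 0 included; it disappears on
    composition with a nonnegative function. *)
Lemma abs_powR_continuous r : 0 < r -> continuous (fun s : R => `|s| `^ r).
Proof.
move=> r0 s; have [->|s0] := eqVneq s 0; last first.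
  apply: (@continuous_comp _ _ _ (fun v : R => `|v|) (fun u : R => u `^ r)).
    exact: norm_continuous.
  apply: differentiable_continuous; apply/derivable1_diffP.
  by apply: derivable_powR; rewrite in_itv /= andbT normr_gt0.
apply/cvgrPdist_lt => e e0; rewrite normr0 powR0 ?gt_eqF //.
apply/nbhs_ballP; exists (e `^ r^-1) => /=; first exact: powR_gt0.
move=> y; rewrite /ball /= !sub0r !normrN (ger0_norm (powR_ge0 _ _)) => ye.
have := gt0_ltr_powR r0 (normr_ge0 y) (powR_ge0 e r^-1) ye.
by rewrite -powRrM mulVf ?gt_eqF // powRr1 // ltW.
Qed.

Lemma powR_continuous (T : topologicalType) (h : T -> R) r : 0 < r ->
  (forall t, 0 <= h t) -> continuous h -> continuous (fun t => h t `^ r).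
Proof.
move=> r0 h0 ch; apply: (@eq_continuous _ _ ((fun s => `|s| `^ r) \o h)).
  by move=> u /=; rewrite ger0_norm.
by move=> t; apply: continuous_comp; [exact: ch | exact: abs_powR_continuous].
Qed.

Definition vcts (T : topologicalType) (f : T -> 'cV[R]_3) :=
  forall i, continuous (fun t => f t i 0).

Lemma vcts_cst (T : topologicalType) (x : 'cV[R]_3) : vcts (fun _ : T => x).
Proof. by move=> i t; exact: cvg_cst. Qed.

Lemma vcts_dot (T : topologicalType) (f g : T -> 'cV[R]_3) :
  vcts f -> vcts g -> continuous (fun t => dot (f t) (g t)).
Proof.
move=> cf cg; apply: (@eq_continuous _ _ (fun t => f t 0 0 * g t 0 0
  + f t 1 0 * g t 1 0 + f t 2 0 * g t 2 0)) => [u|]; first by rewrite dotE.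
by do 2?apply: ctsD; apply: ctsM; first [exact: cf | exact: cg].
Qed.

Lemma vcts_sqn (T : topologicalType) (f : T -> 'cV[R]_3) :
  vcts f -> continuous (fun t => sqn (f t)).
Proof.
move=> cf; apply: (eq_continuous _ (vcts_dot cf cf)) => u.
by rewrite sqnE.
Qed.

Lemma vctsD (T : topologicalType) (f g : T -> 'cV[R]_3) :
  vcts f -> vcts g -> vcts (fun t => f t + g t).
Proof.
move=> cf cg i; apply: (eq_continuous _ (ctsD (cf i) (cg i))) => u.
by rewrite mxE.
Qed.

Lemma vctsZ (T : topologicalType) (f : T -> 'cV[R]_3) (a : R) :
  vcts f -> vcts (fun t => a *: f t).
Proof.
move=> cf i; apply: (@eq_continuous _ _ (fun t => a * f t i 0)) => [u|].
  by rewrite mxE.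
exact: ctsZ.
Qed.

Lemma coord_pow_le x i r : `|sqn x `^ r * x i 0| <= sqn x `^ (r + 2^-1).
Proof.
have [->|x0] := eqVneq x 0; first by rewrite mxE mulr0 normr0 powR_ge0.
rewrite normrM (ger0_norm (powR_ge0 _ _)) powRD; last first.
  by apply/implyP => _; rewrite gt_eqF // sqn_gt0.
rewrite ler_wpM2l ?powR_ge0 // powR12_sqrt ?sqn_ge0 // -sqrtr_sqr.
by rewrite ler_wsqrtr // sqnE coord_le_dot.
Qed.

(** Away from zeros of f this is a composition of continuous maps. At a zero the value is 0 and the
    norm nearby is at most |f|^(2r + 1), whose exponent is positive exactly because r > -1/2. *)
Lemma vcts_pow (T : topologicalType) (f : T -> 'cV[R]_3) r : - 2^-1 < r ->
  vcts f -> vcts (fun t => sqn (f t) `^ r *: f t).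
Proof.
move=> r0 cf i; have cS := vcts_sqn cf.
apply: (@eq_continuous _ _ (fun t => sqn (f t) `^ r * f t i 0)) => [u|t].
  by rewrite mxE.
have [ft0|ft0] := eqVneq (f t) 0; last first.
  apply: (@continuousM _ _ (fun t => sqn (f t) `^ r) (fun t => f t i 0) t);
    last exact: cf.
  apply: (@continuous_comp _ _ _ (fun t => sqn (f t)) (fun u : R => u `^ r)).
    exact: cS.
  apply: differentiable_continuous; apply/derivable1_diffP.
  by apply: derivable_powR; rewrite in_itv /= andbT sqn_gt0.
have r1 : 0 < r + 2^-1 by lra.
have /(_ t)/cvgrPdist_lt := powR_continuous r1 (fun t => sqn_ge0 (f t)) cS.
rewrite ft0 sqn0 powR0 ?gt_eqF // => cp.
apply/cvgrPdist_lt => e e0; rewrite ft0 mxE mulr0.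
apply: filterS (cp e e0) => u; rewrite !sub0r !normrN; apply: le_lt_trans.
by rewrite (ger0_norm (powR_ge0 _ _)) coord_pow_le.
Qed.

Lemma vcts_neq0 (f : R -> 'cV[R]_3) r : vcts f -> f r != 0 ->
  exists2 d, 0 < d & forall t, `|t - r| < d -> f t != 0.
Proof.
move=> cf fr; have cs := vcts_sqn cf; have s0 := sqn_gt0 fr.
have [d d0 hd] := cts_ball (cs r) s0; exists d => // t /hd.
apply: contraTneq => ->; rewrite sqn0 sub0r normrN gtr0_norm //.
by rewrite ltxx.
Qed.

(** Coordinatewise, so that the scalar differentiation rules apply directly. *)
Definition vderiv (f : R -> 'cV[R]_3) (t : R) (l : 'cV[R]_3) :=
  forall i, is_derive t 1 (fun s => f s i 0) (l i 0).

Lemma vderiv_dot (f g : R -> 'cV[R]_3) t l k :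
  vderiv f t l -> vderiv g t k ->
  is_derive t 1 (fun s => dot (f s) (g s)) (dot l (g t) + dot (f t) k).
Proof.
move=> df dg.
rewrite (_ : (fun t => _) = (fun t => f t 0 0 * g t 0 0 + f t 1 0 * g t 1 0
  + f t 2 0 * g t 2 0)); last by apply/funext => u; rewrite dotE.
have := df 0; have := df 1; have := df 2; have := dg 0; have := dg 1; have := dg 2.
by move=> *; apply: is_derive_eq; rewrite !dotE /GRing.scale /=; ring.
Qed.

Lemma vderivD (f g : R -> 'cV[R]_3) t l k :
  vderiv f t l -> vderiv g t k -> vderiv (fun s => f s + g s) t (l + k).
Proof.
move=> df dg i; rewrite (_ : (fun t => _) = (fun t => f t i 0 + g t i 0)).
  by rewrite mxE; have := df i; have := dg i; move=> *; exact: is_deriveD.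
by apply/funext => u; rewrite mxE.
Qed.

Lemma vderivZ (f : R -> 'cV[R]_3) (a : R) t l :
  vderiv f t l -> vderiv (fun s => a *: f s) t (a *: l).
Proof.
move=> df i; rewrite (_ : (fun t => _) = (fun t => a * f t i 0)).
  rewrite mxE; have := df i; move=> *; apply: is_derive_eq.
  by rewrite /GRing.scale /=; ring.
by apply/funext => u; rewrite mxE.
Qed.

Lemma vderiv_pow (f : R -> 'cV[R]_3) t l r : f t != 0 -> vderiv f t l ->
  vderiv (fun s => sqn (f s) `^ r *: f s) t
    (sqn (f t) `^ r *: l
     + (2 * r * sqn (f t) `^ r * dot (f t) l / sqn (f t)) *: f t).
Proof.
move=> ft0 df i; have S0 := sqn_gt0 ft0.
rewrite (_ : (fun t => _) = (fun t => (fun u => u `^ r) (dot (f t) (f t)) * f t i 0));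
  last by apply/funext => u; rewrite mxE sqnE.
have dS := vderiv_dot df df.
have S0' : 0 < dot (f t) (f t) by rewrite -sqnE.
have dP := is_derive1_powR r S0'.
have dC := @is_derive1_comp _ (fun u => u `^ r) _ _ _ _ dP dS.
have := df i => dfi.
have := is_deriveM dC dfi => dM.
apply: (is_derive_eq dM).
rewrite !mxE /GRing.scale /= sqnE powRB; last first.
  by apply/implyP => _; rewrite gt_eqF.
by rewrite powRr1 ?dot_ge0 // (dotC l); field; rewrite gt_eqF.
Qed.

End Vectors.

Lemma powR_subadd (R : realType) (x y r : R) : 0 <= x -> 0 <= y -> 0 < r -> r <= 1 ->
  (x + y) `^ r <= x `^ r + y `^ r.
Proof.
move=> x0 y0 r0 r1.
have [xy0|xy0] := eqVneq (x + y) 0.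
  by rewrite xy0 powR0 ?gt_eqF // addr_ge0 ?powR_ge0.
have xyp : 0 < x + y by rewrite lt_neqAle eq_sym xy0 addr_ge0.
(* The ratio u / (x + y) is at most 1, so raising it to a power r <= 1 does not decrease it; the
   ratios of x and y add up to 1. *)
have key u : 0 <= u -> u <= x + y -> u / (x + y) * (x + y) `^ r <= u `^ r.
  move=> u0 uxy; have [->|un0] := eqVneq u 0.
    by rewrite !mul0r powR_ge0.
  have up : 0 < u by rewrite lt_neqAle eq_sym un0.
  have uq : 0 < u / (x + y) <= 1 by rewrite divr_gt0 //= ler_pdivrMr // mul1r.
  have {2}-> : u = u / (x + y) * (x + y) by field.
  rewrite powRM ?(ltW xyp) //; last by rewrite divr_ge0 // ltW.
  by rewrite ler_wpM2r ?powR_ge0 // ger1_powR.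
have kx : x <= x + y by rewrite lerDl.
have ky : y <= x + y by rewrite lerDr.
have {1}-> : (x + y) `^ r = x / (x + y) * (x + y) `^ r + y / (x + y) * (x + y) `^ r.
  by field.
by rewrite lerD // key.
Qed.

(** * The Lyapunov function *)

Section Lyapunov.
Context {R : realType}.
Variables (p k1 k2 k3 kappa : R).
Hypotheses (hp : 1 < p < 2) (hk1 : 0 < k1) (hk2 : 0 < k2) (hk3 : 0 < k3)
  (hkappa : 1 / 2 < kappa).
Implicit Types (x y z q v : 'cV[R]_3).

Let c := (1 - p) / (3 * p - 2).
Let b := (1 - p) / p.

Let p3 : 0 < 3 * p - 2. Proof. by move/andP: hp => [? ?]; lra. Qed.
Let p0 : 0 < p. Proof. by move/andP: hp => [? ?]; lra. Qed.

Lemma phi_exponent_lt0 : c < 0.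
Proof. by move/andP: hp => [? ?]; rewrite ltr_pdivrMr // mul0r; lra. Qed.

(** This is where p < 2 enters: 2c > -1/2 makes the most singular term of [phi2] continuous at 0,
    and 1 + 2c is positive. *)
Lemma phi_exponent_gt : - 4^-1 < c.
Proof. by move/andP: hp => [? ?]; rewrite ltr_pdivlMr //; lra. Qed.

Lemma psi_exponent_lt0 : b < 0.
Proof. by move/andP: hp => [? ?]; rewrite ltr_pdivrMr // mul0r; lra. Qed.

Lemma psi_exponent_gt : - 2^-1 < b.
Proof. by move/andP: hp => [? ?]; rewrite ltr_pdivlMr //; lra. Qed.

Lemma psi_exponent1E : b + 1 = p^-1.
Proof. by rewrite /b; field; rewrite gt_eqF. Qed.

Lemma exponent_rel : c = (1 + 2 * c) * b.
Proof. by rewrite /b /c; field; rewrite !gt_eqF. Qed.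

Let X x := sqn x `^ c.

Lemma phi1E x : phi1 p k3 x = (k3 + X x) *: x.
Proof. by rewrite /phi1 scalerDl. Qed.

(** The factor k3 + (1 + 2c) |x|^(2c) is the radial eigenvalue of the differential of [phi1], and
    [phi1] is radial, so this displays [phi2] as that differential applied to [phi1]. *)
Lemma phi2E x : phi2 p k3 x = ((k3 + (1 + 2 * c) * X x) * (k3 + X x)) *: x.
Proof.
rewrite /phi2 -!scalerDl; have -> : 2 * (1 - p) / (3 * p - 2) = c + c.
  by rewrite /c; field; rewrite gt_eqF.
rewrite powRD -/(X x); last first.
  by apply/implyP; rewrite -mulr2n mulrn_eq0 /= lt_eqF // phi_exponent_lt0.
by congr (_ *: _); rewrite /X -/c /c; field; rewrite gt_eqF.
Qed.

Lemma vcts_phi1 (T : topologicalType) (f : T -> 'cV[R]_3) :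
  vcts f -> vcts (fun t => phi1 p k3 (f t)).
Proof.
move=> cf; apply: vctsD; first exact: vctsZ.
by apply: vcts_pow => //; have := phi_exponent_gt; rewrite /c; lra.
Qed.

Lemma vcts_phi2 (T : topologicalType) (f : T -> 'cV[R]_3) :
  vcts f -> vcts (fun t => phi2 p k3 (f t)).
Proof.
move=> cf; apply: vctsD; first apply: vctsD; first exact: vctsZ.
- set d := _ / _; move=> i.
  apply: (eq_continuous _ (@vctsZ _ _ _ d (vcts_pow _ cf) i)) => [t|].
    by rewrite !mxE mulrA.
  by have := phi_exponent_gt; rewrite /c; lra.
- set d := _ / _; move=> i.
  apply: (eq_continuous _ (@vctsZ _ _ _ d (vcts_pow _ cf) i)) => [t|].
    by rewrite !mxE mulrA.
  have -> : 2 * (1 - p) / (3 * p - 2) = c + c.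
    by rewrite /c; field; rewrite gt_eqF.
  by have := phi_exponent_gt; rewrite /c; lra.
Qed.

Lemma vcts_psi (T : topologicalType) (f g : T -> 'cV[R]_3) :
  vcts f -> vcts g -> vcts (fun t => psi_t p kappa (f t) (g t)).
Proof.
move=> cf cg; apply: vctsD => //; apply: vctsZ; apply: vctsD => //.
exact: (vcts_pow psi_exponent_gt).
Qed.

(** The matrix P of this form solves the Lyapunov equation A^T P + P A = - 2 k1 diag(k2, 1) for A =
    [A_t k1 k2]. *)
Definition quad y z : R :=
  2 * k2 * dot y y - 2 * k1 * dot y z + (2 + k1 ^+ 2 / k2) * dot z z.

(** Completing the square: the difference is |k2 y - k1 z|^2 / k2. *)
Lemma quad_ge y z : k2 * dot y y + 2 * dot z z <= quad y z.
Proof.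
rewrite -subr_ge0.
have -> : quad y z - (k2 * dot y y + 2 * dot z z) =
  k2^-1 * dot (k2 *: y + (- k1) *: z) (k2 *: y + (- k1) *: z).
  by rewrite /quad !dotE !mxE; field; rewrite gt_eqF.
by rewrite mulr_ge0 ?dot_ge0 // invr_ge0 ltW.
Qed.

(** Chosen so that C (k2 |y|^2 + |z|^2) - [quad y z] is the sum of |k2 y + k1 z|^2 / k2, 2 k1^2
    |y|^2 and |z|^2. *)
Let C := 3 + 2 * k1 ^+ 2 / k2.

Lemma quad_bound_gt0 : 0 < C.
Proof. by rewrite ltr_wpDr // divr_ge0 ?(ltW hk2) // mulr_ge0 ?sqr_ge0. Qed.

Lemma quad_le y z : quad y z <= C * (k2 * dot y y + dot z z).
Proof.
rewrite -subr_ge0.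
have -> : C * (k2 * dot y y + dot z z) - quad y z =
  k2^-1 * dot (k2 *: y + k1 *: z) (k2 *: y + k1 *: z) +
  2 * k1 ^+ 2 * dot y y + dot z z.
  by rewrite /quad /C !dotE !mxE; field; rewrite gt_eqF.
apply: addr_ge0; last exact: dot_ge0.
apply: addr_ge0; apply: mulr_ge0; rewrite ?dot_ge0 ?invr_ge0 ?(ltW hk2) //.
by rewrite mulr_ge0 ?sqr_ge0.
Qed.

Definition lyap_reach x z := quad (phi1 p k3 x) z.

Lemma lyap_reach_ge0 x z : 0 <= lyap_reach x z.
Proof.
apply: le_trans (quad_ge _ _); rewrite addr_ge0 // mulr_ge0 ?dot_ge0 //.
exact: ltW.
Qed.

(* The derivative of phi1 is the matrix whose product with phi1 is phi2; the
   coefficients of [quad] make the cross terms cancel, and the remaining term is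
   the gap in the Cauchy-Schwarz inequality times c < 0. *)
Lemma lyap_reach_derive (f g : R -> 'cV[R]_3) t : f t != 0 ->
  vderiv f t (- k1 *: phi1 p k3 (f t) + g t) ->
  vderiv g t (- k2 *: phi2 p k3 (f t)) ->
  exists2 l, is_derive t 1 (fun s => lyap_reach (f s) (g s)) l &
    l <= - (2 * k1 * (k3 + (1 + 2 * c) * X (f t)) *
       (k2 * dot (phi1 p k3 (f t)) (phi1 p k3 (f t)) + dot (g t) (g t))).
Proof.
move=> f0 df dg; set l := (- k1 *: _ + _) in df; set k := (- k2 *: _) in dg.
have S0 : 0 < dot (f t) (f t) by exact: dot_gt0.
have dF := vderivD (vderivZ k3 df) (vderiv_pow c f0 df).
rewrite -[X in vderiv X]/(fun s => phi1 p k3 (f s)) in dF.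
set dF' := (_ + _) in dF.
have d1 := vderiv_dot dF dF; have d2 := vderiv_dot dF dg; have d3 := vderiv_dot dg dg.
rewrite /lyap_reach /quad.
have D := is_deriveD (is_deriveB (is_deriveZ (2 * k2) d1) (is_deriveZ (2 * k1) d2))
  (is_deriveZ (2 + k1 ^+ 2 / k2) d3).
eexists; first exact: D.
rewrite /GRing.scale /=.
rewrite /dF' /l /k phi2E phi1E.
have cs := cauchy_schwarz (f t) (g t).
rewrite !(dotDl, dotDr, dotZl, dotZr) -!sqnE.
rewrite (dotC (g t) (f t)).
have X0 : 0 <= X (f t) by exact: powR_ge0.
move: X0 S0 cs; rewrite -!sqnE.
set s := sqn (f t); set n := sqn (g t); set w := dot (f t) (g t).
set Y := X (f t); rewrite -/(X (f t)) -/Y => Y0 s0 cs.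
rewrite -subr_ge0; set D' := (X in 0 <= X).
have -> : D' = 4 * k1 * (- c) * Y * ((s * n - w ^+ 2) / s).
  by rewrite /D'; field; rewrite !gt_eqF.
rewrite mulr_ge0 ?divr_ge0 ?subr_ge0 ?(ltW s0) // mulr_ge0 // mulr_ge0 //.
  by rewrite mulr_ge0 // ltW.
by rewrite oppr_ge0 ltW // phi_exponent_lt0.
Qed.

(* Chosen so that the decay of mu * lyap_reach absorbs the |psi|^2 produced by the
   coupling term 2 (e_b . psi). *)
Let mu := (k1 * k2 * k3 ^+ 3)^-1.

Lemma coupling_gt0 : 0 < mu.
Proof. by rewrite invr_gt0 !mulr_gt0 ?exprn_gt0. Qed.

Definition lyap q x z := mu * lyap_reach x z + dot q q.

(** With E = k2 |phi1|^2 + |z|^2, both constants come from E >= V1 / C: [a1] from the linear part of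
    the decay of mu V1, [a2] from its part in E^(1/p). The other arguments of the minima are the
    rates of |e_b|^2; one unit of 2 kappa is spent on 2 (e_b . psi) <= |e_b|^2 + |psi|^2, whence
    kappa > 1/2. *)
Let a1 := k1 * k3 / C.
Let a2 := mu * k1 * (1 + 2 * c) * k2 * (C * k2 * mu)^-1 `^ p^-1.
Definition rate_lin := Num.min a1 (2 * kappa - 1).
Definition rate_pow := Num.min a2 (2 * kappa).

Lemma phi_exponent1_gt0 : 0 < 1 + 2 * c. Proof. by have := phi_exponent_gt; lra. Qed.

Lemma rate_lin_gt0 : 0 < rate_lin.
Proof.
rewrite /rate_lin lt_min; apply/andP; split; last by move: hkappa; lra.
by rewrite divr_gt0 ?mulr_gt0 // quad_bound_gt0.
Qed.

Lemma rate_pow_gt0 : 0 < rate_pow.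
Proof.
rewrite /rate_pow lt_min; apply/andP; split; last by move: hkappa; lra.
have m0 := coupling_gt0; have c0 := phi_exponent1_gt0; have C0 := quad_bound_gt0.
by rewrite !mulr_gt0 // powR_gt0 // invr_gt0 !mulr_gt0.
Qed.

(* [|x|^(1 + 2c) <= |phi1 x|] and [c / (1 + 2c) = (1 - p) / p]. *)
Lemma phi_weight_ge x (E : R) : x != 0 -> k2 * dot (phi1 p k3 x) (phi1 p k3 x) <= E ->
  (E / k2) `^ b <= X x.
Proof.
move=> x0; have s0 := sqn_gt0 x0; have X0 : 0 < X x by exact: powR_gt0.
rewrite phi1E dotZl dotZr -sqnE => hE.
have hs : sqn x `^ (1 + 2 * c) <= E / k2.
  rewrite ler_pdivlMr // mulrC; apply: le_trans hE; rewrite ler_pM2l //.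
  rewrite powRD; last by apply/implyP => _; rewrite gt_eqF.
  rewrite powRr1 ?(ltW s0) // (_ : 2 * c = c + c); last by ring.
  rewrite powRD; last by apply/implyP => _; rewrite gt_eqF.
  rewrite -/(X x) -subr_ge0.
  have -> : (k3 + X x) * ((k3 + X x) * sqn x) - sqn x * (X x * X x) =
    sqn x * (k3 ^+ 2 + 2 * k3 * X x) by ring.
  apply: mulr_ge0; first exact: ltW.
  by rewrite addr_ge0 ?sqr_ge0 // mulr_ge0 ?(ltW X0) // mulr_ge0 // ltW.
have e0 : 0 < E / k2 by apply: lt_le_trans hs; exact: powR_gt0.
rewrite /X exponent_rel (powRrM _ (1 + 2 * c) b).
have bN (u : R) : u `^ b = (u `^ (- b))^-1 by rewrite -powRN opprK.
rewrite !bN lef_pV2 ?posrE ?powR_gt0 //.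
apply: ge0_ler_powR; rewrite ?nnegrE ?powR_ge0 ?(ltW e0) //.
by rewrite oppr_ge0 ltW // psi_exponent_lt0.
Qed.

Lemma powR_exponentM (u : R) : 0 <= u -> u `^ b * u = u `^ p^-1.
Proof.
rewrite le_eqVlt => /orP[/eqP <-|u0].
  by rewrite mulr0 powR0 // invr_eq0 gt_eqF.
rewrite -psi_exponent1E powRD; last by apply/implyP => _; rewrite gt_eqF.
by rewrite powRr1 // ltW.
Qed.

Lemma dot_pos_vel q x v : v = x - kappa *: (q + sqn q `^ b *: q) ->
  2 * dot q v = 2 * dot q x
    - 2 * kappa * (dot q q + dot q q `^ p^-1).
Proof.
move=> ->; rewrite -(powR_exponentM (dot_ge0 q)) -scaleNr.
by rewrite !(dotDr, dotZr) sqnE; ring.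
Qed.

Lemma lyap_decay_sliding q v : v = - kappa *: (q + sqn q `^ b *: q) ->
  2 * dot q v <= - (rate_lin * dot q q + rate_pow * dot q q `^ p^-1).
Proof.
move=> hv; rewrite (@dot_pos_vel q 0 v); last by rewrite hv scaleNr sub0r.
have -> : dot q 0 = 0 by rewrite dotE !mxE; ring.
have l1k : rate_lin <= 2 * kappa - 1 by rewrite /rate_lin ge_min lexx orbT.
have l2k : rate_pow <= 2 * kappa by rewrite /rate_pow ge_min lexx orbT.
have Q0 := dot_ge0 q; have P0 := powR_ge0 (dot q q) p^-1.
have := ler_wpM2r Q0 l1k; have := ler_wpM2r P0 l2k; lra.
Qed.

(** The linear part 2 mu k1 k3 E of the decay is split in two: one half absorbs |psi|^2 ([h1]), the
    other gives a1 mu V1 ([h2]). The part weighted by |psi|^(2c) gives the power of mu V1 ([h3])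
    through [phi_weight_ge]. *)
Lemma lyap_decay_reaching q x z v l : x != 0 ->
  v = x - kappa *: (q + sqn q `^ b *: q) ->
  l <= - (2 * k1 * (k3 + (1 + 2 * c) * X x) *
       (k2 * dot (phi1 p k3 x) (phi1 p k3 x) + dot z z)) ->
  mu * l + 2 * dot q v <= - (rate_lin * lyap q x z + rate_pow * lyap q x z `^ p^-1).
Proof.
move=> x0 hv hl; rewrite (dot_pos_vel hv).
have m0 := coupling_gt0; have c0 := phi_exponent1_gt0; have C0 := quad_bound_gt0.
have X0 : 0 <= X x by exact: powR_ge0.
have s0 := sqn_gt0 x0.
set Fs := dot (phi1 p k3 x) (phi1 p k3 x) in hl *.
have hFs : k3 ^+ 2 * sqn x <= Fs.
  rewrite /Fs phi1E dotZl dotZr -sqnE mulrA; rewrite ler_pM2r //.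
  by rewrite expr2 ler_pM ?(ltW hk3) // lerDl.
set E := k2 * Fs + dot z z in hl.
have hE : k2 * Fs <= E by rewrite lerDl dot_ge0.
have E0 : 0 < E.
  apply: lt_le_trans hE; rewrite mulr_gt0 //; apply: lt_le_trans hFs.
  by rewrite mulr_gt0 // exprn_gt0.
set V := lyap_reach x z; have V0 : 0 <= V := lyap_reach_ge0 x z.
have VE : V <= C * E by exact: quad_le.
have mV0 : 0 <= mu * V := mulr_ge0 (ltW m0) V0.
have hqx : 2 * dot q x <= dot q q + sqn x.
  have := dot_ge0 (q + (- 1) *: x).
  by rewrite !(dotDl, dotDr, dotZl, dotZr) (dotC x q) sqnE; lra.
(* The value of mu is the one that makes this hold, as E >= k2 k3^2 |psi|^2. *)
have h1 : sqn x <= mu * k1 * k3 * E.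
  have -> : sqn x = mu * k1 * k3 * (k2 * (k3 ^+ 2 * sqn x)).
    by rewrite /mu; field; rewrite !gt_eqF.
  rewrite ler_pM2l ?mulr_gt0 //; apply: le_trans hE.
  by rewrite ler_pM2l.
have h2 : a1 * (mu * V) <= mu * k1 * k3 * E.
  have -> : mu * k1 * k3 * E = a1 * (mu * (C * E)).
    by rewrite /a1; field; rewrite gt_eqF.
  by rewrite ler_pM2l ?divr_gt0 ?mulr_gt0 // ler_pM2l.
have h3 : a2 * (mu * V) `^ p^-1 <= mu * k1 * ((1 + 2 * c) * X x) * E.
  have XE : k2 * (E / k2) `^ p^-1 <= X x * E.
    have Ek : 0 <= E / k2 by rewrite divr_ge0 // ltW.
    rewrite -(powR_exponentM Ek).
    have -> : k2 * ((E / k2) `^ b * (E / k2)) = (E / k2) `^ b * E.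
      by field; rewrite gt_eqF.
    by rewrite ler_pM2r // phi_weight_ge.
  have hp' : (C * k2 * mu)^-1 `^ p^-1 * (mu * V) `^ p^-1 <= (E / k2) `^ p^-1.
    have D0 : 0 < (C * k2 * mu)^-1 by rewrite invr_gt0 !mulr_gt0.
    rewrite -(powRM _ (ltW D0) mV0).
    have -> : (C * k2 * mu)^-1 * (mu * V) = V / (C * k2).
      by field; rewrite !gt_eqF.
    apply: ge0_ler_powR; rewrite ?nnegrE ?invr_ge0 ?(ltW p0) //.
    - by rewrite divr_ge0 // mulr_ge0 // ltW.
    - by rewrite divr_ge0 // ltW.
    rewrite ler_pdivrMr ?mulr_gt0 //.
    by have -> : E / k2 * (C * k2) = C * E by field; rewrite gt_eqF.
  have A0 : 0 < mu * k1 * (1 + 2 * c) by rewrite !mulr_gt0.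
  have -> : mu * k1 * ((1 + 2 * c) * X x) * E = mu * k1 * (1 + 2 * c) * (X x * E).
    by ring.
  rewrite /a2 -!mulrA !ler_pM2l // ?mulrA; apply: le_trans XE.
  by rewrite -mulrA ler_pM2l.
have h4 : mu * l <= - (2 * (mu * k1 * k3 * E) + mu * k1 * ((1 + 2 * c) * X x) * E).
  apply: (@le_trans _ _ (mu * - (2 * k1 * (k3 + (1 + 2 * c) * X x) * E))).
    by rewrite ler_pM2l.
  have : 0 <= mu * k1 * ((1 + 2 * c) * X x) * E.
    by rewrite mulr_ge0 ?(ltW E0) // mulr_ge0 ?mulr_ge0 ?(ltW m0) ?(ltW hk1) ?(ltW c0).
  lra.
have Q0 := dot_ge0 q.
have P0 := powR_ge0 (dot q q) p^-1; have P1 := powR_ge0 (mu * V) p^-1.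
(* Since 1/p <= 1, the separate powers of mu V1 and |e_b|^2 dominate the power of their sum. *)
have sub : lyap q x z `^ p^-1 <= (mu * V) `^ p^-1 + dot q q `^ p^-1.
  apply: powR_subadd; rewrite ?invr_gt0 // invf_le1 //.
  by case/andP: hp => /ltW.
have l1k : rate_lin <= 2 * kappa - 1 by rewrite /rate_lin ge_min lexx orbT.
have l2k : rate_pow <= 2 * kappa by rewrite /rate_pow ge_min lexx orbT.
have l1a : rate_lin <= a1 by rewrite /rate_lin ge_min lexx.
have l2a : rate_pow <= a2 by rewrite /rate_pow ge_min lexx.
have := ler_wpM2r Q0 l1k; have := ler_wpM2r P0 l2k.
have := ler_wpM2r mV0 l1a; have := ler_wpM2r P1 l2a.
have : rate_pow * lyap q x z `^ p^-1 <= rate_pow * ((mu * V) `^ p^-1 + dot q q `^ p^-1).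
  by rewrite ler_pM2l // rate_pow_gt0.
have -> : lyap q x z = mu * V + dot q q by [].
lra.
Qed.

Lemma lyap_reach_continuous (T : topologicalType) (f g : T -> 'cV[R]_3) :
  vcts f -> vcts g -> continuous (fun t => lyap_reach (f t) (g t)).
Proof.
move=> cf cg; have cF := vcts_phi1 cf.
apply: (@eq_continuous _ _ (fun t =>
  2 * k2 * dot (phi1 p k3 (f t)) (phi1 p k3 (f t))
  + (- (2 * k1)) * dot (phi1 p k3 (f t)) (g t)
  + (2 + k1 ^+ 2 / k2) * dot (g t) (g t))).
  by move=> t; rewrite /lyap_reach /quad mulNr.
by do 2?apply: ctsD; apply: ctsZ; apply: vcts_dot.
Qed.

Lemma lyap_continuous (T : topologicalType) (e f g : T -> 'cV[R]_3) :
  vcts e -> vcts f -> vcts g -> continuous (fun t => lyap (e t) (f t) (g t)).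
Proof.
move=> ce cf cg; apply: ctsD; last exact: vcts_dot.
by apply: ctsZ; exact: lyap_reach_continuous.
Qed.

Lemma lyap_reach_eq0 x y : lyap_reach x y = 0 -> x = 0 /\ y = 0.
Proof.
move=> V0; have := quad_ge (phi1 p k3 x) y; rewrite -/(lyap_reach _ _) V0 => h.
have F0 := dot_ge0 (phi1 p k3 x); have y0 := dot_ge0 y.
have kF0 : 0 <= k2 * dot (phi1 p k3 x) (phi1 p k3 x) by rewrite mulr_ge0 // ltW.
have /eqP : dot y y = 0 by lra.
rewrite dot_eq0 => /eqP ->; split=> //.
have /eqP : k2 * dot (phi1 p k3 x) (phi1 p k3 x) = 0 by lra.
rewrite mulf_eq0 (gt_eqF hk2) /= dot_eq0 phi1E scaler_eq0.
by rewrite gt_eqF ?ltr_pwDl ?powR_ge0 //= => /eqP.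
Qed.

Lemma lyap_reach_00 : lyap_reach 0 0 = 0.
Proof. by rewrite /lyap_reach /quad phi1E scaler0 !dotE !mxE; ring. Qed.

Lemma lyap_ge0 q x z : 0 <= lyap q x z.
Proof. by rewrite addr_ge0 ?dot_ge0 // mulr_ge0 ?lyap_reach_ge0 // ltW // coupling_gt0. Qed.

Lemma dot_q_le q x z : dot q q <= lyap q x z.
Proof. by rewrite /lyap lerDr mulr_ge0 ?lyap_reach_ge0 // ltW // coupling_gt0. Qed.

Lemma dot_x_le q x z : dot x x <= k1 * k3 * lyap q x z.
Proof.
have hF : k3 ^+ 2 * dot x x <= dot (phi1 p k3 x) (phi1 p k3 x).
  rewrite phi1E dotZl dotZr mulrA ler_wpM2r ?dot_ge0 //.
  by rewrite expr2 ler_pM ?(ltW hk3) // lerDl powR_ge0.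
have hV : k2 * dot (phi1 p k3 x) (phi1 p k3 x) <= lyap_reach x z.
  by apply: le_trans (quad_ge _ _); rewrite lerDl mulr_ge0 ?dot_ge0.
have -> : dot x x = k1 * k3 * (mu * (k2 * (k3 ^+ 2 * dot x x))).
  by rewrite /mu; field; rewrite !gt_eqF.
rewrite ler_pM2l ?mulr_gt0 // /lyap; apply: (@le_trans _ _ (mu * lyap_reach x z)).
  rewrite ler_pM2l ?coupling_gt0 //; apply: le_trans hV.
  by rewrite ler_pM2l.
by rewrite lerDl dot_ge0.
Qed.

Lemma dot_z_le q x z : dot z z <= k1 * k2 * k3 ^+ 3 / 2 * lyap q x z.
Proof.
have hV : 2 * dot z z <= lyap_reach x z.
  apply: le_trans (quad_ge _ _); rewrite lerDr mulr_ge0 ?dot_ge0 //.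
  exact: ltW.
have -> : dot z z = k1 * k2 * k3 ^+ 3 / 2 * (mu * (2 * dot z z)).
  by rewrite /mu; field; rewrite !gt_eqF.
rewrite ler_pM2l ?divr_gt0 ?mulr_gt0 ?exprn_gt0 //.
apply: (@le_trans _ _ (mu * lyap_reach x z)); first by rewrite ler_pM2l ?coupling_gt0.
by rewrite /lyap lerDl dot_ge0.
Qed.

End Lyapunov.

(** * The settling time as a function of the Lyapunov value *)

Section Settling.
Context {R : realType}.
Variables (a b alpha : R).
Hypotheses (a0 : 0 < a) (b0 : 0 < b) (halpha : 0 < alpha < 1).

Definition settling (w : R) : R :=
  1 / (a * (1 - alpha)) * ln ((a * w `^ (1 - alpha) + b) / b).

Let e0 : 0 < 1 - alpha. Proof. by case/andP: halpha => _; rewrite subr_gt0. Qed.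

Let arg_ge1 w : 1 <= (a * w `^ (1 - alpha) + b) / b.
Proof. by rewrite ler_pdivlMr // mul1r lerDr mulr_ge0 ?powR_ge0 // ltW. Qed.

Let k0 : 0 < 1 / (a * (1 - alpha)). Proof. by rewrite divr_gt0 // mulr_gt0. Qed.

Lemma settling_ge0 w : 0 <= settling w.
Proof. by rewrite mulr_ge0 ?(ltW k0) // ln_ge0. Qed.

Lemma settling_gt0 w : 0 < w -> 0 < settling w.
Proof.
move=> w0; rewrite mulr_gt0 // ln_gt0 // ltr_pdivlMr // mul1r ltrDr.
by rewrite mulr_gt0 // powR_gt0.
Qed.

Lemma settling_lt x y : 0 <= x -> x < y -> settling x < settling y.
Proof.
move=> x0 xy; rewrite ltr_pM2l // ltr_ln ?posrE ?(lt_le_trans ltr01) //.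
rewrite ltr_pM2r ?invr_gt0 // ltrD2r ltr_pM2l //.
by apply: gt0_ltr_powR; rewrite ?nnegrE // (le_trans x0) // ltW.
Qed.

Lemma settling_continuous (T : topologicalType) (h : T -> R) :
  (forall t, 0 <= h t) -> continuous h -> continuous (fun t => settling (h t)).
Proof.
move=> h0 ch; apply: ctsZ.
have cp : continuous (fun t => (a * h t `^ (1 - alpha) + b) / b).
  apply: ctsM => [|t]; last exact: cvg_cst.
  apply: ctsD => [|t]; last exact: cvg_cst.
  by apply: ctsZ; exact: powR_continuous.
move=> t; apply: (@continuous_comp _ _ _
  (fun t => (a * h t `^ (1 - alpha) + b) / b) (@ln R)); first exact: cp.
by apply: continuous_ln; exact: lt_le_trans (arg_ge1 _).
Qed.

(** The function [settling] is a primitive of 1 / (a w + b w^alpha), as a w + b w^alpha = (a w^(1 -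
    alpha) + b) w^alpha. It therefore decreases at rate at least 1 whenever h' <= - (a h + b
    h^alpha). *)
Lemma settling_derive (h : R -> R) t l : 0 < h t -> is_derive t 1 h l ->
  is_derive t 1 (fun s => settling (h s)) (l / (a * h t + b * h t `^ alpha)).
Proof.
move=> ht dh.
have p1 := powR_gt0 (1 - alpha) ht; have p2 := powR_gt0 alpha ht.
have dP := @is_derive1_comp _ (fun u => u `^ (1 - alpha)) _ _ _ _
  (is_derive1_powR (1 - alpha) ht) dh.
have dA : is_derive t 1 (fun s => (a * h s `^ (1 - alpha) + b) / b)
    (a / b * (l * ((1 - alpha) * h t `^ (1 - alpha - 1)))).
  rewrite (_ : (fun s => _) = (fun s => a / b * (h s `^ (1 - alpha)) + 1)).
    by apply: is_derive_eq; rewrite /GRing.scale /=; ring.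
  by apply/funext => s; field; rewrite gt_eqF.
have pos : 0 < (a * h t `^ (1 - alpha) + b) / b by exact: lt_le_trans (arg_ge1 _).
have dL := @is_derive1_comp _ (@ln R)
  (fun s => (a * h s `^ (1 - alpha) + b) / b) _ _ _ (is_derive1_ln pos) dA.
have dZ := is_deriveZ (1 / (a * (1 - alpha))) dL.
apply: (is_derive_eq dZ); rewrite /GRing.scale /=.
have -> : h t `^ (1 - alpha - 1) = (h t `^ alpha)^-1.
  by rewrite -powRN; congr (_ `^ _); ring.
have hE : a * h t + b * h t `^ alpha =
    (a * h t `^ (1 - alpha) + b) * h t `^ alpha.
  rewrite mulrDl -mulrA -powRD; last by apply/implyP => _; rewrite gt_eqF.
  by rewrite subrK powRr1 // ltW.
rewrite hE; field.
rewrite (gt_eqF a0) (gt_eqF b0) (gt_eqF e0) (gt_eqF p2) /=.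
by rewrite gt_eqF // addr_gt0 // mulr_gt0.
Qed.

End Settling.

(** This is the derivative of x + |x|^(2b) x in the direction y, b = (1 - p)/p, in the form that
    [vderiv_pow] produces; the sign in [Hmx] is absorbed by (p - 1)/p = - b. *)
Lemma H_termE (R : realType) (p : R) (x y : 'cV[R]_3) :
  H_term p x y = sqn x `^ ((1 - p) / p) *: y +
    (2 * ((1 - p) / p) * sqn x `^ ((1 - p) / p) * dot x y / sqn x) *: x + y.
Proof.
pose b := (1 - p) / p; rewrite /H_term -/b; congr (_ + _).
have -> : Hmx x ((p - 1) / p) *m y = y + (2 * b * dot x y / sqn x) *: x.
  rewrite /Hmx mulmxBl mul1mx -scalemxAl -mulmxA; congr (_ + _).
  rewrite -scaleNr; have -> : x^T *m y = (dot x y)%:M.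
    apply/matrixP => i j; rewrite !ord1 mxE mxE eqxx mulr1n.
    by apply: eq_bigr => k _; rewrite mxE.
  rewrite mul_mx_scalar scalerA; congr (_ *: _).
  by rewrite /b; ring.
by rewrite scalerDr scalerA -/b; congr (_ + _ *: _); ring.
Qed.

Lemma psi_t0 (R : realType) (p kappa : R) : psi_t p kappa 0 0 = 0.
Proof. by rewrite /psi_t !scaler0 !addr0 scaler0 addr0. Qed.

(** * Trajectories *)

Section Trajectory.
Context {R : realType}.
Variables (p k1 k2 k3 kappa B : R) (q v z : R -> 'cV[R]_3).
Hypotheses (hp : 1 < p < 2) (hk1 : 0 < k1) (hk2 : 0 < k2) (hk3 : 0 < k3)
  (hkappa : 1 / 2 < kappa).
Let b := (1 - p) / p.
Let psi t := psi_t p kappa (q t) (v t).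
Hypotheses (cq : vcts q) (cv : vcts v) (cz : vcts z).
Hypothesis dq : forall t, 0 < t -> t < B -> vderiv q t (v t).
Hypothesis dz : forall t, 0 < t -> t < B -> vderiv z t (- k2 *: phi2 p k3 (psi t)).
Hypothesis dv : forall t, 0 < t -> t < B -> q t != 0 ->
  vderiv v t (- k1 *: phi1 p k3 (psi t) - kappa *: H_term p (q t) (v t) + z t).
(* The equation for v says nothing at the zeros of q; this is what survives of it
   on an interval where q and v vanish. *)
Hypothesis zero_z : forall s t, 0 <= s -> s < t -> t <= B ->
  exists r, [/\ s < r, r < t & q r = 0 -> v r = 0 -> z r = 0].

Lemma vcts_psi_t : vcts psi.
Proof. exact: vcts_psi. Qed.

(** The term - kappa [H_term] of v' cancels the derivative of kappa (q + |q|^(2b) q). *)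
Lemma psi_derive t : 0 < t -> t < B -> q t != 0 ->
  vderiv psi t (- k1 *: phi1 p k3 (psi t) + z t).
Proof.
move=> t0 tB qt.
have D := vderivD (dv t0 tB qt)
  (vderivZ kappa (vderivD (dq t0 tB) (vderiv_pow b qt (dq t0 tB)))).
move=> i; apply: (is_derive_eq (D i)).
by rewrite H_termE -/b !mxE; ring.
Qed.

(** If q r = 0 then v r is nonzero, and q . (v r) has derivative v . (v r), positive near r; being
    strictly monotone there, it vanishes at r only. *)
Lemma q_neq0_near r : 0 <= r -> r < B -> ~ (q r = 0 /\ v r = 0) ->
  exists2 d, 0 < d & forall t, 0 <= t -> t <= B -> t != r -> `|t - r| < d ->
    q t != 0.
Proof.
move=> r0 rB nZ.
have [qr|qr] := eqVneq (q r) 0; last first.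
  by have [d d0 hd] := vcts_neq0 cq qr; exists d => // t _ _ _; exact: hd.
have vr : v r != 0 by apply/eqP => vr; exact: nZ.
have cw : continuous (fun t => dot (v t) (v r)).
  by apply: vcts_dot => // i t; exact: cvg_cst.
have [d d0 hd] := cts_ball (cw r) (dot_gt0 vr).
exists d => // t t0 tB tr td; apply/eqP => qt.
have cu : continuous (fun t => dot (q t) (v r)).
  by apply: vcts_dot => // i s; exact: cvg_cst.
have du s : 0 < s -> s < B -> `|s - r| < d ->
    exists2 l, is_derive s 1 (fun t => dot (q t) (v r)) l & 0 < l.
  move=> s0 sB sd; exists (dot (v s) (v r)); last first.
    by have := hd s sd; rewrite ltr_norml => /andP[]; lra.
  have D := @vderiv_dot _ q (fun=> v r) s (v s) 0 (dq s0 sB).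
  apply: (is_derive_eq (D _)) => [i|].
    by rewrite mxE; exact: is_derive_cst.
  by rewrite !dotE !mxE; ring.
move: td; rewrite ltr_norml => /andP[td1 td2].
have qd0 : dot (q t) (v r) = dot (q r) (v r) by rewrite qt qr.
have [tr'|rt|/eqP] := ltgtP t r; last by rewrite (negbTE tr).
- have : dot (q t) (v r) < dot (q r) (v r).
    apply: (derive_gt0_increasing cu (a := t) (b := r)) => // s ts sr.
    apply: du; [lra|lra|rewrite ltr_norml; apply/andP; split; lra].
  by rewrite qd0 ltxx.
- have : dot (q r) (v r) < dot (q t) (v r).
    apply: (derive_gt0_increasing cu (a := r) (b := t)) => // s ts sr.
    apply: du; [lra|lra|rewrite ltr_norml; apply/andP; split; lra].
  by rewrite qd0 ltxx.
Qed.

Lemma psi_neq0_right r : 0 <= r -> r < B -> psi r != 0 ->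
  exists2 d, 0 < d & forall t, r < t -> t < r + d ->
    [/\ t < B, q t != 0 & psi t != 0].
Proof.
move=> r0 rB pr.
have [|d d0 hd] := q_neq0_near r0 rB.
  by move=> [qr vr]; move: pr; rewrite /psi qr vr psi_t0 eqxx.
have [d' d'0 hd'] := vcts_neq0 vcts_psi_t pr.
exists (Num.min (B - r) (Num.min d d')).
  by rewrite !lt_min subr_gt0 rB d0 d'0.
move=> t rt td.
have [h1 [h2 h3]] : t - r < B - r /\ t - r < d /\ t - r < d'.
  have : t - r < Num.min (B - r) (Num.min d d') by lra.
  by rewrite !lt_min => /andP[? /andP[]].
have tr : `|t - r| = t - r by rewrite ger0_norm // subr_ge0 ltW.
split; first by lra.
- by apply: hd; rewrite ?tr ?gt_eqF //; lra.
- by apply: hd'; rewrite tr.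
Qed.

(* Here psi may fail to be differentiable at r, and q = v = 0 may happen at
   further times; the component of psi along z r is nevertheless increasing. *)
Lemma psi_neq0_right_of_zero r : 0 <= r -> r < B -> psi r = 0 -> z r != 0 ->
  exists2 d, 0 < d & forall t, r < t -> t < r + d -> t < B /\ psi t != 0.
Proof.
move=> r0 rB pr zr; have n0 := dot_gt0 zr.
have c0 : vcts (fun _ : R => z r) by exact: vcts_cst.
have cf : vcts (fun t => - k1 *: phi1 p k3 (psi t) + z t).
  by apply: vctsD => //; apply: vctsZ; apply: vcts_phi1 => //; exact: vcts_psi_t.
(* This is the derivative of psi . (z r) given by [psi_derive]. It is continuous even at zeros of q
   and equals |z r|^2 at r, so it is positive nearby. *)
have cc : continuous (fun t => dot (- k1 *: phi1 p k3 (psi t) + z t) (z r)).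
  exact: vcts_dot.
have [d1 d10 hd1] := cts_ball (cc r) n0.
have [d2 d20 hd2] := vcts_neq0 cz zr.
pose d := Num.min (B - r) (Num.min d1 d2).
have [hB [h1 h2]] : d <= B - r /\ d <= d1 /\ d <= d2.
  by rewrite /d; split; [|split]; rewrite !ge_min !lexx ?orbT.
have d0 : 0 < d by rewrite !lt_min subr_gt0 rB d10 d20.
pose w t := dot (psi t) (z r).
have cw : continuous w by exact: vcts_dot vcts_psi_t c0.
have dw s : r < s -> s < r + d -> q s != 0 ->
    exists2 l, is_derive s 1 w l & 0 < l.
  move=> rs sd qs; exists (dot (- k1 *: phi1 p k3 (psi s) + z s) (z r)); last first.
    have := hd1 s; rewrite gtr0_norm ?subr_gt0 // => /(_ ltac:(lra)).
    rewrite [X in _ - X](_ : _ = dot (z r) (z r)).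
      by rewrite ltr_norml => /andP[]; lra.
    by rewrite pr phi1E ?scaler0 ?add0r.
  have s0 : 0 < s by lra.
  have sB : s < B by lra.
  have D := @vderiv_dot _ psi (fun=> z r) s _ 0 (psi_derive s0 sB qs).
  apply: (is_derive_eq (D _)) => [i|].
    by rewrite mxE; exact: is_derive_cst.
  by rewrite [dot (psi s) 0](_ : _ = 0) ?addr0 // !dotE !mxE; ring.
have wpos : forall t, r < t -> t < r + d -> 0 < w t.
  apply: (pos_right_of_zero (Z := [set t | q t = 0 /\ v t = 0]) cw).
  - by rewrite /w pr dotE !mxE; ring.
  - move=> s _ _ [qs vs]; rewrite /w /psi qs vs psi_t0 dotE !mxE; ring.
  - move=> s rs sd nZ.
    have s0 : 0 <= s by lra.
    have sB : s < B by lra.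
    have [e e0 he] := q_neq0_near s0 sB nZ.
    pose e' := Num.min e (Num.min (s - r) (r + d - s)).
    have [k_1 [k_2 k_3]] : e' <= e /\ e' <= s - r /\ e' <= r + d - s.
      by rewrite /e'; split; [|split]; rewrite !ge_min !lexx ?orbT.
    have e'0 : 0 < e' by rewrite !lt_min e0 !subr_gt0 rs sd.
    exists e' => // t; split => [se ts|st te].
      apply: (derive_gt0_increasing cw (a := t) (b := s)) => // x tx xs.
      apply: dw; [lra|lra|apply: he; [lra|lra|by rewrite lt_eqF|]].
      by rewrite ltr_norml; apply/andP; split; lra.
    apply: (derive_gt0_increasing cw (a := s) (b := t)) => // x tx xs.
    apply: dw; [lra|lra|apply: he; [lra|lra|by rewrite gt_eqF|]].
    by rewrite ltr_norml; apply/andP; split; lra.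
  (* As z does not vanish near r, the point found by [zero_z] cannot satisfy q = v = 0. *)
  - move=> s t rs st td.
    have [||| x [sx xt hx]] := @zero_z s t; [lra|lra|lra|].
    exists x; split => // -[qx vx].
    have : z x != 0 by apply: hd2; rewrite gtr0_norm ?subr_gt0; lra.
    by rewrite hx ?eqxx.
exists d => // t rt td; split; first by lra.
by apply: contraTneq (wpos t rt td) => pt; rewrite /w pt dotE !mxE; lra.
Qed.

(** Kept for a general U because it serves twice, for V1 and for T(V) + t. Where psi r = 0 but z r
    is nonzero, psi is nonzero at all points just after r, and continuity of U covers r itself. *)
Lemma observable_right_nonincreasing (U : R -> R) r : continuous U ->
  (forall s, 0 < s -> s < B -> q s != 0 -> psi s != 0 ->
     exists2 l, is_derive s 1 U l & l <= 0) ->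
  0 <= r -> r < B -> psi r != 0 \/ z r != 0 -> right_nonincreasing U r.
Proof.
move=> cU dU.
have H s : 0 <= s -> s < B -> psi s != 0 -> right_nonincreasing U s.
  move=> s0 sB ps; have [d d0 hd] := psi_neq0_right s0 sB ps.
  apply: (right_nonincreasing_derive cU d0) => x sx xd.
  by have [xB qx px] := hd x sx xd; apply: dU => //; lra.
move=> r0 rB pz; have [pr|pr] := eqVneq (psi r) 0; last exact: H.
have zr : z r != 0 by case: pz => //; rewrite pr eqxx.
have [d d0 hd] := psi_neq0_right_of_zero r0 rB pr zr.
apply: (right_nonincreasing_of_right cU d0) => s rs sd.
by have [sB ps] := hd s rs sd; apply: H => //; lra.
Qed.


Let Vt t := lyap_reach p k1 k2 k3 (psi t) (z t).
Let Wt t := lyap p k1 k2 k3 (q t) (psi t) (z t).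
Let la := rate_lin k1 k2 k3 kappa.
Let lb := rate_pow p k1 k2 k3 kappa.

Let la0 : 0 < la. Proof. exact: rate_lin_gt0. Qed.
Let lb0 : 0 < lb. Proof. exact: rate_pow_gt0. Qed.

Let halpha : 0 < p^-1 < 1.
Proof.
move/andP: hp => [p1 _]; rewrite invr_gt0 invf_lt1 ?p1 ?andbT; lra.
Qed.

Let V_cts : continuous Vt.
Proof. by apply: lyap_reach_continuous => //; exact: vcts_psi_t. Qed.

Let Wt_ge0 t : 0 <= Wt t.
Proof. exact: lyap_ge0. Qed.

Let lyap_cts : continuous Wt.
Proof. by apply: lyap_continuous => //; exact: vcts_psi_t. Qed.

Lemma reaching_neq0 t : Vt t != 0 -> psi t != 0 \/ z t != 0.
Proof.
move=> V0; have [pt|pt] := eqVneq (psi t) 0; last by left.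
right; apply: contra_neq V0 => zt.
by rewrite /Vt pt zt (lyap_reach_00 p k1 k2 k3).
Qed.

Lemma lyap_reach_derive_le0 s : 0 < s -> s < B -> q s != 0 -> psi s != 0 ->
  exists2 l, is_derive s 1 Vt l & l <= 0.
Proof.
move=> s0 sB qs ps.
have [l dl hl] := lyap_reach_derive hp hk1 hk2 ps (psi_derive s0 sB qs) (dz s0 sB).
exists l => //; apply: (le_trans hl); rewrite oppr_le0 mulr_ge0 //.
  rewrite mulr_ge0 ?mulr_ge0 ?(ltW hk1) // addr_ge0 ?(ltW hk3) //.
  by rewrite mulr_ge0 ?powR_ge0 // ltW // phi_exponent1_gt0.
by rewrite addr_ge0 ?dot_ge0 // mulr_ge0 ?dot_ge0 // ltW.
Qed.

(** V1 vanishes at s, and wherever it is positive it is nonincreasing to the right; the points psi =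
    z = 0, about which nothing is known locally, are exactly those that [right_nonincreasing_le_gt]
    leaves out. *)
Lemma sliding_invariant s t : 0 <= s -> s <= t -> t <= B ->
  psi s = 0 -> z s = 0 -> psi t = 0 /\ z t = 0.
Proof.
move=> s0 st tB ps zs; apply: (lyap_reach_eq0 (p := p) (k1 := k1) hk2 hk3).
apply/eqP; rewrite eq_le lyap_reach_ge0 // andbT.
have Vs : Vt s = 0 by rewrite /Vt ps zs (lyap_reach_00 p k1 k2 k3).
rewrite -Vs -/(Vt t); apply: right_nonincreasing_le_gt => //.
move=> r sr rt Vr; apply: observable_right_nonincreasing; try lra.
- exact: V_cts.
- exact: lyap_reach_derive_le0.
- by apply: reaching_neq0; rewrite gt_eqF // -Vs.
Qed.

Let U t := settling la lb p^-1 (Wt t) + t.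

Lemma U_continuous : continuous U.
Proof.
apply: ctsD; last by move=> t; exact: cvg_id.
by apply: settling_continuous => // t; exact: lyap_ge0.
Qed.

Lemma vel_from_psi t : v t = psi t - kappa *: (q t + sqn (q t) `^ b *: q t).
Proof. by rewrite /psi /psi_t addrK. Qed.

Lemma settling_rate_le (w l : R) : 0 < w -> l <= - (la * w + lb * w `^ p^-1) ->
  l / (la * w + lb * w `^ p^-1) + 1 <= 0.
Proof.
move=> w0 hl.
have d0 : 0 < la * w + lb * w `^ p^-1.
  by rewrite addr_gt0 ?mulr_gt0 // powR_gt0.
by rewrite -lerBrDr sub0r ler_pdivrMr // mulN1r.
Qed.

Lemma U_derive_le0 s : 0 < s -> s < B -> q s != 0 -> psi s != 0 ->
  exists2 l, is_derive s 1 U l & l <= 0.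
Proof.
move=> s0 sB qs ps.
have [l dl hl] := lyap_reach_derive hp hk1 hk2 ps (psi_derive s0 sB qs) (dz s0 sB).
have dQ := vderiv_dot (dq s0 sB) (dq s0 sB).
have dW := is_deriveD (is_deriveZ (k1 * k2 * k3 ^+ 3)^-1 dl) dQ.
have W0 : 0 < Wt s.
  rewrite ltr_wpDl ?dot_gt0 // mulr_ge0 ?lyap_reach_ge0 // ltW // coupling_gt0 //.
have dS := settling_derive la0 lb0 halpha W0 dW.
have dU := is_deriveD dS (is_derive_id s 1).
eexists; first exact: dU.
apply: settling_rate_le => //.
have := lyap_decay_reaching hp hk1 hk2 hk3 hkappa ps (vel_from_psi s) hl.
by rewrite /GRing.scale /= (dotC (v s)) -/(Wt s) -/la -/lb; lra.
Qed.

(** Either (psi, z) is nonzero at r, or it vanishes from r on and V reduces to |q|^2. Positivity of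
    V at r keeps the argument of [settling] away from 0, where its power is not smooth. *)
Lemma lyap_right_nonincreasing r : 0 <= r -> r < B -> 0 < Wt r ->
  right_nonincreasing U r.
Proof.
move=> r0 rB Wr.
have [/eqP|/reaching_neq0] := boolP (Vt r == 0); last first.
  exact: observable_right_nonincreasing U_continuous U_derive_le0 r0 rB.
move=> /(lyap_reach_eq0 hk2 hk3)[pr zr].
have inv t : r <= t -> t <= B -> psi t = 0 /\ z t = 0.
  by move=> rt tB; exact: (sliding_invariant r0 rt tB).
pose Q t := dot (q t) (q t).
have WQ t : r <= t -> t <= B -> Wt t = Q t.
  move=> rt tB; have [pt zt] := inv t rt tB.
  by rewrite /Wt /lyap pt zt (lyap_reach_00 p k1 k2 k3) mulr0 add0r.
have Qr : 0 < Q r by rewrite -WQ // ltW.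
have cQ : continuous Q by exact: vcts_dot.
have [d d0 hd] := cts_ball (cQ r) Qr.
pose e := Num.min d (B - r).
have [ed eB] : e <= d /\ e <= B - r by rewrite /e !ge_min !lexx orbT.
have e0 : 0 < e by rewrite lt_min d0 subr_gt0.
(* From r on, U and [UQ] coincide, and [right_nonincreasing] looks at nothing else; [UQ] can be
   differentiated through q alone. *)
pose UQ t := settling la lb p^-1 (Q t) + t.
have cUQ : continuous UQ.
  apply: ctsD; last by move=> t; exact: cvg_id.
  by apply: settling_continuous => // t; exact: dot_ge0.
have [e' e'0 he'] : right_nonincreasing UQ r.
  apply: (right_nonincreasing_derive cUQ e0) => s rs se.
  have s0 : 0 < s by lra.
  have sB : s < B by lra.
  have Qs : 0 < Q s.
    have := hd s; rewrite gtr0_norm ?subr_gt0 // => /(_ ltac:(lra)).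
    by rewrite ltr_norml => /andP[]; lra.
  have dQ := vderiv_dot (dq s0 sB) (dq s0 sB).
  have dS := settling_derive la0 lb0 halpha Qs dQ.
  have dU := is_deriveD dS (is_derive_id s 1).
  eexists; first exact: dU.
  apply: settling_rate_le => //.
  have vs : v s = - kappa *: (q s + sqn (q s) `^ b *: q s).
    have [ps _] := inv s (ltW rs) (ltW sB).
    by rewrite vel_from_psi ps sub0r scaleNr.
  have := lyap_decay_sliding k1 k2 k3 hp vs.
  by rewrite (dotC (v s)) -/la -/lb /Q; lra.
exists (Num.min e e'); first by rewrite lt_min e0.
move=> s rs; rewrite -ltrBlDl lt_min => /andP[se se'].
rewrite /U !WQ //; try lra.
by apply: he'; lra.
Qed.

(** A rise of V just after r would raise T(V), hence T(V) + t, against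
    [lyap_right_nonincreasing]. *)
Lemma lyap_nonincreasing t : 0 <= t -> t <= B -> forall s, 0 <= s -> s <= t -> Wt t <= Wt s.
Proof.
move=> t0 tB s s0 st; apply: right_nonincreasing_le_gt => //.
move=> r sr rt Wr.
have Wr0 : 0 < Wt r by apply: le_lt_trans Wr; exact: lyap_ge0.
have [||d d0 hd] := lyap_right_nonincreasing (r := r) _ _ Wr0; try lra.
exists d => // x rx xd; rewrite leNgt; apply/negP => Wx.
have := hd x rx xd; rewrite /U.
have := settling_lt la0 lb0 halpha (Wt_ge0 _) Wx.
by rewrite -/(Wt r); lra.
Qed.

(** If V were positive at t it would be positive on all of [0, t] by monotonicity, so T(V t) + t <=
    T(V 0) <= t, whereas T(V t) > 0. *)
Lemma settling_time t : 0 <= t -> t <= B -> settling la lb p^-1 (Wt 0) <= t -> Wt t = 0.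
Proof.
move=> t0 tB Tt; apply/eqP; rewrite eq_le Wt_ge0 andbT leNgt; apply/negP => Wt0.
have : U t <= U 0.
  apply: right_nonincreasing_le => //; first exact: U_continuous.
  move=> r r0 rt _; apply: lyap_right_nonincreasing => //; first by lra.
  by apply: lt_le_trans Wt0 _; apply: lyap_nonincreasing => //; lra.
rewrite /U addr0.
have := settling_gt0 la0 lb0 halpha Wt0; rewrite -/(Wt t); lra.
Qed.

End Trajectory.

(** * Solutions extended continuously to the whole line *)

Lemma coord_le_norm (R : realType) n (y : 'cV[R]_n) i : `|y i 0| <= `|y|.
Proof.
rewrite [leRHS]/Num.Def.normr/= mx_normrE.
exact: (le_bigmax _ (fun ij : 'I_n * 'I_1 => `|y ij.1 ij.2|) (i, 0)).
Qed.

Lemma norm_le_coord (R : realType) n (y : 'cV[R]_n) (e : R) : 0 <= e -> (forall i, `|y i 0| <= e) ->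
  `|y| <= e.
Proof.
move=> e0 h; rewrite [leLHS]/Num.Def.normr/= mx_normrE (bigmax_le _ e0) //=.
by move=> [i j] _ /=; rewrite ord1.
Qed.

Lemma ac_uniform (R : realType) (y : R -> R) a b e : absolutely_continuous y a b -> 0 < e ->
  exists2 d, 0 < d & forall s t, a <= s -> s <= t -> t <= b -> t - s < d ->
    `|y t - y s| < e.
Proof.
move=> acy e0; have [d d0 hd] := acy e e0; exists d => // s t as_ st tb std.
have := hd 1%N (fun=> s) (fun=> t).
rewrite !big_ord_recl !big_ord0 !addr0; apply=> // i j _ _ _.
by rewrite !ord1.
Qed.

Section ClampedSolution.
Context {R : realType} {N : nat}.
Variables (F : 'cV[R]_N -> 'cV[R]_N) (tau : \bar R) (x : R -> 'cV[R]_N) (B : R).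
Hypotheses (xF : solution F tau x) (B0 : 0 < B) (Btau : (B%:E < tau)%E).

(* Extends a solution from [0, B] to a continuous function on the whole line. *)
Definition clamp (t : R) := Num.max 0 (Num.min t B).

Lemma clamp_itv t : 0 <= clamp t <= B.
Proof. by rewrite /clamp le_max lexx ge_max (ltW B0) ge_min lexx orbT. Qed.

Lemma clamp_id t : 0 <= t -> t <= B -> clamp t = t.
Proof. by move=> t0 tB; rewrite /clamp min_l // max_r. Qed.

Lemma clamp_contract s t : `|clamp s - clamp t| <= `|s - t|.
Proof.
have spec u : [\/ u < 0 /\ clamp u = 0, 0 <= u <= B /\ clamp u = u |
    B < u /\ clamp u = B].
  have [uB|uB] := leP u B; last first.
    by apply: Or33; rewrite /clamp min_r ?max_r ?(ltW B0) // ltW.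
  have [u0|u0] := leP 0 u; first by apply: Or32; rewrite clamp_id // u0.
  by apply: Or31; rewrite /clamp min_l // max_l // ltW.
have h1 := ler_norm (s - t); have h2 := ler_norm (t - s).
rewrite distrC in h2; have h0 := normr_ge0 (s - t); move: B0 => b0.
rewrite ler_norml; have [[? ->]|[/andP[? ?] ->]|[? ->]] := spec s;
  have [[? ->]|[/andP[? ?] ->]|[? ->]] := spec t; apply/andP; split; lra.
Qed.

Lemma coord_ac i : absolutely_continuous (fun t => x t i 0) 0 B.
Proof.
case: xF => _ acx _ e e0; have [d d0 hd] := acx 0 B (lexx _) (ltW B0) Btau e e0.
exists d => // n l r lr tlr slr; apply: le_lt_trans (hd n l r lr tlr slr).
apply: ler_sum => j _.
by have := coord_le_norm (x (r j) - x (l j)) i; rewrite !mxE.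
Qed.

Lemma clamp_continuous i : continuous (fun t => x (clamp t) i 0).
Proof.
move=> t; apply/cvgrPdist_lt => e e0.
have [d d0 hd] := ac_uniform (coord_ac i) e0.
apply/nbhs_ballP; exists d => // s; rewrite /ball /= => ts.
have := clamp_contract t s; move: (clamp_itv t) (clamp_itv s).
move=> /andP[c1 c2] /andP[c3 c4] h.
have {}h := le_lt_trans h ts.
have [st|st] := leP (clamp s) (clamp t).
  by apply: hd => //; move: h; rewrite ltr_norml => /andP[].
rewrite distrC; apply: hd => //; first exact: ltW.
by move: h; rewrite distrC ltr_norml => /andP[].
Qed.

(** Works one coordinate at a time: the position and disturbance components of the error field are
    continuous along every solution, the velocity component possibly not where e_b = 0. *)
Lemma clamp_derive i s : 0 < s -> s < B ->
  {for s, continuous (fun t => F (x (clamp t)) i 0)} ->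
  is_derive s 1 (fun t => x (clamp t) i 0) (F (x (clamp s)) i 0).
Proof.
move=> s0 sB cF.
apply: (@near_eq_is_derive _ _ _ (fun t => x t i 0)).
  apply/nbhs_ballP; exists (Num.min s (B - s)).
    by rewrite /= lt_min s0 subr_gt0.
  move=> t; rewrite /ball /= lt_min !ltr_norml => /andP[/andP[h1 h2] /andP[h3 h4]].
  by rewrite clamp_id //; lra.
apply: (@ac_ae_is_derive _ _ (fun t => F (x (clamp t)) i 0) 0 B) => //.
  exact: coord_ac.
case: xF => _ _ ae; apply: (ae_imp ae) => t h t0 tB.
have [||dx xE] := h; [exact: ltW | exact: lt_trans Btau|].
rewrite clamp_id ?ltW // -xE; split; first exact: ((derivable_mxP x t 1).1 dx i 0).
by rewrite !derive1E derive_mx // mxE.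
Qed.

End ClampedSolution.

Lemma near_eq_continuous (R : realType) (f g : R -> R) (r : R) :
  (\near r, f r = g r) -> {for r, continuous f} -> {for r, continuous g}.
Proof.
move=> fg cf; have e := nbhs_singleton fg; rewrite /prop_for /continuous_at -e.
by apply: cvg_trans cf; exact: near_eq_cvg.
Qed.

(** * The error field *)

Section ErrorField.
Context {R : realType}.
Variables (p m k1 k2 k3 kappa : R).
Hypotheses (hp : 1 < p < 2) (hm : 0 < m) (hk1 : 0 < k1) (hk2 : 0 < k2)
  (hk3 : 0 < k3) (hkappa : 1 / 2 < kappa).

Let F := @error_field R p m k1 k2 k3 kappa.
Let b := (1 - p) / p.

Definition err_pos (e : 'cV[R]_(3 + (3 + 3))) : 'cV[R]_3 := usubmx e.
Definition err_vel (e : 'cV[R]_(3 + (3 + 3))) : 'cV[R]_3 := usubmx (dsubmx e).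
(** Dividing by m removes the mass from the equations in (e_b, e_v, z). *)
Definition err_dist (e : 'cV[R]_(3 + (3 + 3))) : 'cV[R]_3 := m^-1 *: dsubmx (dsubmx e).

Lemma err_pos_field e : err_pos (F e) = err_vel e.
Proof. by rewrite /err_pos /F /error_field col_mxKu. Qed.

Lemma err_vel_field e : err_vel (F e) =
  - k1 *: phi1 p k3 (psi_t p kappa (err_pos e) (err_vel e))
  - kappa *: H_term p (err_pos e) (err_vel e) + err_dist e.
Proof.
rewrite /err_vel /F /error_field col_mxKd col_mxKu scalerDr; congr (_ + _).
rewrite scalerDr !scalerN !scalerA !mulrA mulVf ?gt_eqF // !mul1r.
by rewrite scaleNr.
Qed.

Lemma err_dist_field e : err_dist (F e) = - k2 *: phi2 p k3 (psi_t p kappa (err_pos e) (err_vel e)).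
Proof.
rewrite /err_dist /F /error_field !col_mxKd scalerN scalerA mulrA mulVf ?gt_eqF //.
by rewrite mul1r scaleNr.
Qed.

Lemma error_field0 : F 0 = 0.
Proof.
have e0 : err_pos 0 = 0 /\ err_vel 0 = 0 /\ err_dist 0 = 0.
  by rewrite /err_pos /err_vel /err_dist !linear0.
case: e0 => q0 [v0 z0].
have psi0 := psi_t0 p kappa.
rewrite /F /error_field -/(err_vel 0) -/(err_pos 0) q0 v0 psi0 phi1E (phi2E _ hp) !linear0.
rewrite /H_term mulmx0 !(scaler0, addr0, subr0, oppr0).
by rewrite col_mx0 col_mx0.
Qed.

Lemma H_term_continuous (q v : R -> 'cV[R]_3) s i : vcts q -> vcts v -> q s != 0 ->
  {for s, continuous (fun t => H_term p (q t) (v t) i 0)}.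
Proof.
move=> cq cv qs.
rewrite (_ : (fun t => _) = (fun t => sqn (q t) `^ b * v t i 0
  + (2 * b * sqn (q t) `^ b * dot (q t) (v t) * (sqn (q t))^-1) * q t i 0 + v t i 0));
  last by apply/funext => t; rewrite H_termE !mxE.
have cS := vcts_sqn cq; have S0 := sqn_gt0 qs.
have cP : {for s, continuous (fun t => sqn (q t) `^ b)}.
  apply: (@continuous_comp _ _ _ (fun t => sqn (q t)) (fun u : R => u `^ b)).
    exact: cS.
  apply: differentiable_continuous; apply/derivable1_diffP.
  by apply: derivable_powR; rewrite in_itv /= andbT.
have cI : {for s, continuous (fun t => (sqn (q t))^-1)}.
  by apply: cvgV; [rewrite gt_eqF | exact: cS].
have cqi : {for s, continuous (fun t => q t i 0)} by exact: cq.
have cvi : {for s, continuous (fun t => v t i 0)} by exact: cv.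
have cD : {for s, continuous (fun t => dot (q t) (v t))} by exact: vcts_dot.
have c2 : {for s, continuous (fun _ : R => 2 * b)} by exact: cvg_cst.
exact: (continuousD (continuousD (continuousM cP cvi)
  (continuousM (continuousM (continuousM (continuousM c2 cP) cD) cI) cqi)) cvi).
Qed.

Definition energy e :=
  lyap p k1 k2 k3 (err_pos e) (psi_t p kappa (err_pos e) (err_vel e)) (err_dist e).

Let la := rate_lin k1 k2 k3 kappa.
Let lb := rate_pow p k1 k2 k3 kappa.

Section Solution.
Variables (tau : \bar R) (x : R -> 'cV[R]_(3 + (3 + 3))) (B : R).
Hypotheses (xF : solution F tau x) (B0 : 0 < B) (Btau : (B%:E < tau)%E).

Let X t := x (clamp B t).

Let cX j : continuous (fun t => X t j 0).
Proof. exact: clamp_continuous xF B0 Btau j. Qed.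

Lemma vcts_err_pos : vcts (fun t => err_pos (X t)).
Proof.
move=> i; apply: (@eq_continuous _ _ (fun t => X t (lshift _ i) 0)) => // t.
by rewrite /err_pos mxE.
Qed.

Lemma vcts_err_vel : vcts (fun t => err_vel (X t)).
Proof.
move=> i; apply: (@eq_continuous _ _ (fun t => X t (rshift 3 (lshift 3 i)) 0)) => // t.
by rewrite /err_vel !mxE.
Qed.

Lemma vcts_err_dist : vcts (fun t => err_dist (X t)).
Proof.
apply: vctsZ => i.
apply: (@eq_continuous _ _ (fun t => X t (rshift 3 (rshift 3 i)) 0)) => // t.
by rewrite !mxE.
Qed.

Lemma err_pos_derive s : 0 < s -> s < B -> vderiv (fun t => err_pos (X t)) s (err_vel (X s)).
Proof.
move=> s0 sB i.
have E t : F (X t) (lshift _ i) 0 = err_vel (X t) i 0.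
  by rewrite -err_pos_field [RHS]mxE.
have D := @clamp_derive _ _ _ _ _ _ xF B0 Btau (lshift _ i) s s0 sB.
rewrite -E (_ : (fun t => _) = (fun t => X t (lshift _ i) 0)).
  apply: D; rewrite (_ : (fun t => _) = (fun t => err_vel (X t) i 0)).
    exact: vcts_err_vel.
  by apply/funext => t; exact: E.
by apply/funext => t; rewrite /err_pos mxE.
Qed.

Lemma err_dist_derive s : 0 < s -> s < B ->
  vderiv (fun t => err_dist (X t)) s
    (- k2 *: phi2 p k3 (psi_t p kappa (err_pos (X s)) (err_vel (X s)))).
Proof.
move=> s0 sB; rewrite -err_dist_field; apply: vderivZ => i.
set j := rshift 3 (rshift 3 i).
have E t : F (X t) j 0 = m * err_dist (F (X t)) i 0.
  by rewrite /err_dist !mxE mulrA mulfV ?mul1r ?gt_eqF.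
have D := @clamp_derive _ _ _ _ _ _ xF B0 Btau j s s0 sB.
rewrite (_ : (fun t => _) = (fun t => X t j 0)); last first.
  by apply/funext => t; rewrite !mxE.
rewrite 2!mxE; apply: D; rewrite (_ : (fun t => _) = (fun t => m * err_dist (F (X t)) i 0)).
  apply: ctsZ; move: i {E} j => i j.
  rewrite (_ : (fun t => _) = (fun t => (- k2 *: phi2 p k3
     (psi_t p kappa (err_pos (X t)) (err_vel (X t)))) i 0)).
    apply: vctsZ; apply: vcts_phi2 => //; apply: vcts_psi => //.
      exact: vcts_err_pos.
    exact: vcts_err_vel.
  by apply/funext => t; rewrite err_dist_field.
by apply/funext => t; exact: E.
Qed.

(** Continuity stays a hypothesis because it has two sources: e_b nonzero at s, or e_b = e_v = 0 on
    a whole neighbourhood of s. *)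
Lemma err_vel_derive_gen s i : 0 < s -> s < B ->
  {for s, continuous (fun t => err_vel (F (X t)) i 0)} ->
  is_derive s 1 (fun t => err_vel (X t) i 0) (err_vel (F (X s)) i 0).
Proof.
move=> s0 sB cs; set j := rshift 3 (lshift 3 i).
have E e : err_vel e i 0 = e j 0 by rewrite /err_vel !mxE.
rewrite E (_ : (fun t => _) = (fun t => X t j 0)); last first.
  by apply/funext => t; rewrite E.
apply: (clamp_derive xF B0 Btau) => //.
by move: cs; rewrite (_ : (fun t => _) = (fun t => F (X t) j 0)) //; apply/funext => t.
Qed.

Lemma err_vel_derive s : 0 < s -> s < B -> err_pos (X s) != 0 ->
  vderiv (fun t => err_vel (X t)) s
    (- k1 *: phi1 p k3 (psi_t p kappa (err_pos (X s)) (err_vel (X s)))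
     - kappa *: H_term p (err_pos (X s)) (err_vel (X s)) + err_dist (X s)).
Proof.
move=> s0 sB qs i; rewrite -err_vel_field; apply: err_vel_derive_gen => //.
rewrite (_ : (fun t => _) = (fun t =>
  (- k1 *: phi1 p k3 (psi_t p kappa (err_pos (X t)) (err_vel (X t)))) i 0 +
  (- kappa) * H_term p (err_pos (X t)) (err_vel (X t)) i 0 + err_dist (X t) i 0)); last first.
  by apply/funext => t; rewrite err_vel_field !mxE; ring.
have c1 : vcts (fun t => - k1 *: phi1 p k3 (psi_t p kappa (err_pos (X t)) (err_vel (X t)))).
  apply: vctsZ; apply: vcts_phi1 => //; apply: vcts_psi => //.
    exact: vcts_err_pos.
  exact: vcts_err_vel.
have c1s : {for s, continuous (fun t =>
  (- k1 *: phi1 p k3 (psi_t p kappa (err_pos (X t)) (err_vel (X t)))) i 0)} by exact: c1.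
have c2 : {for s, continuous (fun t => err_dist (X t) i 0)} by exact: vcts_err_dist.
have c3 := H_term_continuous (i := i) vcts_err_pos vcts_err_vel qs.
have c4 : {for s, continuous (fun _ : R => - kappa)} by exact: cvg_cst.
exact: (continuousD (continuousD c1s (continuousM c4 c3)) c2).
Qed.

(** If e_b = e_v = 0 on an interval, the velocity equation reduces there to e_v' = z, while e_v is
    constant; hence z = 0. If some point of the interval has e_b or e_v nonzero, that point
    satisfies the implication vacuously. *)
Lemma err_dist_zero s t : 0 <= s -> s < t -> t <= B ->
  exists r, [/\ s < r, r < t & err_pos (X r) = 0 -> err_vel (X r) = 0 -> err_dist (X r) = 0].
Proof.
move=> s0 st tB; apply: contrapT => H.
have Z r : s < r -> r < t -> err_pos (X r) = 0 /\ err_vel (X r) = 0.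
  move=> sr rt; apply: contrapT => nZ; apply: H; exists r; split => // qr vr.
  by case: nZ.
pose r := (s + t) / 2.
have sr : s < r by rewrite /r; lra.
have rt : r < t by rewrite /r; lra.
apply: H; exists r; split => // qr vr.
have nearZ : \forall u \near r, err_pos (X u) = 0 /\ err_vel (X u) = 0.
  apply/nbhs_ballP; exists (Num.min (r - s) (t - r)).
    by rewrite /= lt_min !subr_gt0 sr.
  move=> u; rewrite /ball /= lt_min !ltr_norml => /andP[/andP[? ?] /andP[? ?]].
  by apply: Z; lra.
have FE u : err_pos (X u) = 0 -> err_vel (X u) = 0 -> err_vel (F (X u)) = err_dist (X u).
  move=> qu vu; rewrite err_vel_field qu vu psi_t0 phi1E /H_term mulmx0.
  by rewrite !(scaler0, addr0, oppr0, add0r).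
apply/colP => i; rewrite [RHS]mxE -FE //.
have D : is_derive r 1 (fun t => err_vel (X t) i 0) (err_vel (F (X r)) i 0).
  apply: err_vel_derive_gen; [lra | lra |].
  apply: (@near_eq_continuous _ (fun t => err_dist (X t) i 0)); last exact: vcts_err_dist.
  by apply: filterS nearZ => u [qu vu]; rewrite FE.
have D0 : is_derive r 1 (fun t => err_vel (X t) i 0) 0.
  apply: (@near_eq_is_derive _ _ _ (cst (0 : R))).
    by apply: filterS nearZ => u [_ ->]; rewrite mxE.
by case: D => _ <-; case: D0 => _ ->.
Qed.

Lemma energy_nonincreasing t : 0 <= t -> t <= B -> energy (x t) <= energy (x 0).
Proof.
move=> t0 tB.
have := lyap_nonincreasing hp hk1 hk2 hk3 hkappa vcts_err_pos vcts_err_vel vcts_err_dist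
  err_pos_derive err_dist_derive err_vel_derive err_dist_zero t0 tB (lexx 0) t0.
by rewrite /X !clamp_id // ltW.
Qed.

Lemma energy_settling t : 0 <= t -> t <= B ->
  settling la lb p^-1 (energy (x 0)) <= t -> energy (x t) = 0.
Proof.
move=> t0 tB Tt.
have := settling_time hp hk1 hk2 hk3 hkappa vcts_err_pos vcts_err_vel vcts_err_dist
  err_pos_derive err_dist_derive err_vel_derive err_dist_zero t0 tB.
by rewrite /X !clamp_id ?(ltW B0) //; apply.
Qed.

End Solution.

End ErrorField.

(** * Stability of the error field *)

Lemma time_horizon (R : realType) (tau : \bar R) (t : R) :
  (0 < tau)%E -> 0 <= t -> (t%:E < tau)%E ->
  exists B, [/\ 0 < B, t <= B & (B%:E < tau)%E].
Proof.
move=> tau0 t0; case: tau tau0 => [s|_ _|//].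
  rewrite !lte_fin => s0 ts; exists ((t + s) / 2); rewrite lte_fin.
  by split; lra.
by exists (t + 1); rewrite ltry; split => //; lra.
Qed.

Section Stability.
Context {R : realType}.
Variables (p m k1 k2 k3 kappa : R).
Hypotheses (hp : 1 < p < 2) (hm : 0 < m) (hk1 : 0 < k1) (hk2 : 0 < k2)
  (hk3 : 0 < k3) (hkappa : 1 / 2 < kappa).

Let F := @error_field R p m k1 k2 k3 kappa.
Let b := (1 - p) / p.
Let E := energy p m k1 k2 k3 kappa.

(** Adds bounds for e_b, e_v and e_phi when V = w; the middle one comes from e_v = psi - kappa (e_b
    + |e_b|^(2b) e_b). All exponents are positive, so the bound tends to 0 with w. *)
Definition norm_bound (w : R) : R :=
  w `^ 2^-1 + ((k1 * k3 * w) `^ 2^-1 + kappa * (w `^ 2^-1 + w `^ (b + 2^-1)))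
  + m * (k1 * k2 * k3 ^+ 3 / 2 * w) `^ 2^-1.

Let b2 : 0 < b + 2^-1. Proof. by have := psi_exponent_gt hp; rewrite -/b; lra. Qed.

Let kappa0 : 0 < kappa. Proof. by move: hkappa; lra. Qed.

Let h20 : 0 < 2^-1 :> R. Proof. by rewrite invr_gt0. Qed.

Let kk0 : 0 < k1 * k3. Proof. exact: mulr_gt0. Qed.

Let kkk0 : 0 < k1 * k2 * k3 ^+ 3 / 2.
Proof. by rewrite divr_gt0 ?mulr_gt0 ?exprn_gt0. Qed.

Let powR_le (u w r : R) : 0 < r -> 0 <= u -> u <= w -> u `^ r <= w `^ r.
Proof.
by move=> r0 u0 uw; apply: ge0_ler_powR => //; rewrite ?nnegrE ?(ltW r0) ?(le_trans u0).
Qed.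

Lemma norm_bound_mono u w : 0 <= u -> u <= w -> norm_bound u <= norm_bound w.
Proof.
move=> u0 uw; have h (k : R) : 0 < k -> 0 <= k * u /\ k * u <= k * w.
  by move=> k0; rewrite mulr_ge0 ?(ltW k0) // ler_pM2l.
have [a1 a2] := h _ kk0; have [a3 a4] := h _ kkk0.
by rewrite !lerD ?ler_pM2l ?lerD // powR_le.
Qed.

Lemma norm_bound0 : norm_bound 0 = 0.
Proof.
by rewrite /norm_bound !mulr0 !powR0 ?(gt_eqF b2) ?(gt_eqF h20) //; ring.
Qed.

Lemma norm_bound_continuous (T : topologicalType) (h : T -> R) :
  (forall t, 0 <= h t) -> continuous h -> continuous (fun t => norm_bound (h t)).
Proof.
move=> h0 ch.
have c1 (k : R) : 0 < k -> continuous (fun t => (k * h t) `^ 2^-1).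
  move=> k0; apply: powR_continuous => // [t|]; last exact: ctsZ.
  by rewrite mulr_ge0 // ltW.
apply: ctsD; last by apply: ctsZ; exact: c1.
apply: ctsD; first exact: powR_continuous.
apply: ctsD; first exact: c1.
by apply: ctsZ; apply: ctsD; exact: powR_continuous.
Qed.

Lemma coord_le_sqrt (y : 'cV[R]_3) i w : dot y y <= w -> `|y i 0| <= w `^ 2^-1.
Proof.
move=> yw; apply: (@le_trans _ _ (dot y y `^ 2^-1)); last first.
  by apply: powR_le => //; exact: dot_ge0.
rewrite powR12_sqrt ?dot_ge0 // -sqrtr_sqr ler_wsqrtr //.
exact: coord_le_dot.
Qed.

Lemma energy_ge0 e : 0 <= E e.
Proof. exact: lyap_ge0. Qed.

Lemma norm_le_energy e : `|e| <= norm_bound (E e).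
Proof.
have E0 := energy_ge0 e.
set w := E e in E0 *.
have hq i : `|err_pos e i 0| <= w `^ 2^-1 by apply: coord_le_sqrt; exact: dot_q_le.
have hx i : `|psi_t p kappa (err_pos e) (err_vel e) i 0| <= (k1 * k3 * w) `^ 2^-1.
  by apply: coord_le_sqrt; exact: dot_x_le.
have hz i : `|err_dist m e i 0| <= (k1 * k2 * k3 ^+ 3 / 2 * w) `^ 2^-1.
  by apply: coord_le_sqrt; exact: dot_z_le.
have hv i : `|err_vel e i 0| <=
    (k1 * k3 * w) `^ 2^-1 + kappa * (w `^ 2^-1 + w `^ (b + 2^-1)).
  have -> : err_vel e i 0 = psi_t p kappa (err_pos e) (err_vel e) i 0
      - kappa * (err_pos e i 0 + sqn (err_pos e) `^ b * err_pos e i 0).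
    by rewrite /psi_t !mxE; ring.
  apply: (le_trans (ler_normB _ _)); apply: lerD => //.
  rewrite normrM (gtr0_norm kappa0) ler_pM2l //.
  apply: (le_trans (ler_normD _ _)); apply: lerD => //.
  apply: (le_trans (coord_pow_le _ _ _)); apply: powR_le => //.
    exact: sqn_ge0.
  by rewrite sqnE; exact: dot_q_le.
have ge0 (u r : R) : 0 <= u `^ r by exact: powR_ge0.
have g1 : 0 <= kappa * (w `^ 2^-1 + w `^ (b + 2^-1)).
  by rewrite mulr_ge0 ?(ltW kappa0) // addr_ge0.
have g2 : 0 <= m * (k1 * k2 * k3 ^+ 3 / 2 * w) `^ 2^-1 by rewrite mulr_ge0 // ltW.
have g3 := ge0 w 2^-1; have g4 := ge0 (k1 * k3 * w) 2^-1.
apply: norm_le_coord; first by rewrite /norm_bound; lra.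
move=> i; case: (split_ordP i) => j ->.
  have -> : e (lshift _ j) 0 = err_pos e j 0 by rewrite /err_pos mxE.
  by have := hq j; rewrite /norm_bound; lra.
case: (split_ordP j) => k ->.
  have -> : e (rshift 3 (lshift 3 k)) 0 = err_vel e k 0 by rewrite /err_vel !mxE.
  by have := hv k; rewrite /norm_bound; lra.
have -> : e (rshift 3 (rshift 3 k)) 0 = m * err_dist m e k 0.
  by rewrite /err_dist !mxE mulrA mulfV ?mul1r ?gt_eqF.
rewrite normrM (gtr0_norm hm).
have : m * `|err_dist m e k 0| <= m * (k1 * k2 * k3 ^+ 3 / 2 * w) `^ 2^-1 by rewrite ler_pM2l.
by rewrite /norm_bound; lra.
Qed.

Lemma energy_continuous : continuous E.
Proof.
pose T : topologicalType := 'cV[R]_(3 + (3 + 3)).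
have cc j : continuous (fun e : T => e j 0) by exact: coord_continuous.
have cp : vcts (fun e : T => err_pos e).
  move=> i; apply: (eq_continuous _ (cc (lshift _ i))) => e.
  by rewrite /err_pos mxE.
have cv : vcts (fun e : T => err_vel e).
  move=> i; apply: (eq_continuous _ (cc (rshift 3 (lshift 3 i)))) => e.
  by rewrite /err_vel !mxE.
have ca : vcts (fun e : T => err_dist m e).
  apply: vctsZ => i; apply: (eq_continuous _ (cc (rshift 3 (rshift 3 i)))) => e.
  by rewrite !mxE.
by apply: (@lyap_continuous _ _ _ _ _ _ T) => //; exact: vcts_psi.
Qed.

Lemma energy0 : E 0 = 0.
Proof.
have e0 : err_pos (0 : 'cV[R]_(3 + (3 + 3))) = 0 /\ err_vel (0 : 'cV[R]_(3 + (3 + 3))) = 0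
    /\ err_dist m (0 : 'cV[R]_(3 + (3 + 3))) = 0.
  by rewrite /err_pos /err_vel /err_dist !linear0.
case: e0 => q0 [v0 z0].
by rewrite /E /energy q0 v0 z0 psi_t0 /lyap lyap_reach_00 dotE !mxE; ring.
Qed.

Lemma energy_pos_def : positive_definite E.
Proof.
split; first exact: energy0.
move=> e e0; rewrite lt_neqAle energy_ge0 andbT eq_sym.
apply: contraNneq e0 => Ee; rewrite -normr_le0 (le_trans (norm_le_energy e)) //.
by rewrite Ee norm_bound0.
Qed.

Lemma energy_le (tau : \bar R) (x : R -> 'cV[R]_(3 + (3 + 3))) t :
  solution F tau x -> 0 <= t -> (t%:E < tau)%E -> E (x t) <= E (x 0).
Proof.
move=> xF t0 tt; have [tau0 _ _] := xF.
(* Trajectory results hold on a compact [0, B] with B < tau; any B beyond t will do. *)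
have [B [B0 tB Bt]] := time_horizon tau0 t0 tt.
exact: (energy_nonincreasing hp hm hk1 hk2 hk3 hkappa xF B0 Bt).
Qed.

(** V never exceeds its initial value, so [norm_bound] of that value controls the solution; it is
    continuous in the initial error and vanishes at 0. *)
Lemma error_field_stable : lyapunov_stable F.
Proof.
move=> eps eps0.
have cN := norm_bound_continuous energy_ge0 energy_continuous.
have /cvgrPdist_lt/(_ eps eps0)/nbhs_ballP[d /= d0 hd] := cN 0.
exists d => // tau x xF x0d t t0 tt.
apply: (le_lt_trans (norm_le_energy _)).
apply: (@le_lt_trans _ _ (norm_bound (E (x 0)))).
  by apply: norm_bound_mono; [exact: energy_ge0 | exact: energy_le xF t0 tt].
have := hd (x 0); rewrite -ball_normE /ball_ /= sub0r normrN => /(_ x0d).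
by rewrite energy0 norm_bound0 sub0r normrN; exact: le_lt_trans (ler_norm _).
Qed.

Lemma error_field_ffts : fast_finite_time_stable F.
Proof.
have halpha : 0 < p^-1 < 1.
  by case/andP: hp => p1 _; rewrite invr_gt0 invf_lt1; lra.
split; [exact: error_field0 | exact: error_field_stable |].
exists E, (rate_lin k1 k2 k3 kappa), (rate_pow p k1 k2 k3 kappa), p^-1; split => //.
- exact: energy_continuous.
- exact: energy_pos_def.
- by split; [exact: rate_lin_gt0 | exact: rate_pow_gt0].
move=> tau x xF; split.
  move=> _; exists (norm_bound (E (x 0))) => t t0 tt.
  apply: (le_trans (norm_le_energy _)).
  by apply: norm_bound_mono; [exact: energy_ge0 | exact: energy_le xF t0 tt].
(* The time T is the bound itself, with alpha = 1/p from the power term of the decay. *)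
exists (settling (rate_lin k1 k2 k3 kappa) (rate_pow p k1 k2 k3 kappa) p^-1 (E (x 0))).
have T0 := settling_ge0 (rate_lin_gt0 hk1 hk2 hk3 hkappa) (rate_pow_gt0 hp hk1 hk2 hk3 hkappa)
  halpha (E (x 0)).
split => // t Tt tt; have t0 := le_trans T0 Tt; have [tau0 _ _] := xF.
have [B [B0 tB Bt]] := time_horizon tau0 t0 tt.
have Et := energy_settling hp hm hk1 hk2 hk3 hkappa xF B0 Bt t0 tB Tt.
apply/eqP; rewrite -normr_le0 (le_trans (norm_le_energy _)) //.
by rewrite /E Et norm_bound0.
Qed.

End Stability.

(** * Derivation of the error equations *)

Section ErrorDynamics.
Context {R : realType}.

Lemma acB (V : normedModType R) (f g : R -> V) a b :
  absolutely_continuous f a b -> absolutely_continuous g a b ->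
  absolutely_continuous (fun t => f t - g t) a b.
Proof.
move=> acf acg e e0; have e2 : 0 < e / 2 by rewrite divr_gt0.
have [d1 d10 h1] := acf _ e2; have [d2 d20 h2] := acg _ e2.
exists (Num.min d1 d2); first by rewrite lt_min d10.
move=> n l r lr tlr; rewrite lt_min => /andP[s1 s2].
have H1 := h1 n l r lr tlr s1; have H2 := h2 n l r lr tlr s2.
rewrite (splitr e); apply: le_lt_trans (ltrD H1 H2).
rewrite -big_split /=; apply: ler_sum => i _.
have -> : f (r i) - g (r i) - (f (l i) - g (l i)) =
    (f (r i) - f (l i)) - (g (r i) - g (l i)).
  by rewrite !opprB [g (l i) - f (l i)]addrC addrACA [- g (r i) + _]addrC.
exact: ler_normB.
Qed.

Lemma locally_acB (V : normedModType R) (f g : R -> V) tau :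
  locally_ac f tau -> locally_ac g tau -> locally_ac (fun t => f t - g t) tau.
Proof. by move=> hf hg a b a0 ab bt; apply: acB; [exact: hf | exact: hg]. Qed.

Lemma derive1B (V : normedModType R) (f g : R -> V) t :
  derivable f t 1 -> derivable g t 1 ->
  (fun s => f s - g s)^`()%classic t = f^`()%classic t - g^`()%classic t.
Proof. by move=> df dg; rewrite !derive1E deriveB. Qed.

End ErrorDynamics.

(** Gravity and thrust enter the vehicle and the observer identically and cancel in the difference,
    at almost every time where all the derivatives exist. *)
Lemma observer_error_dynamics (R : realType) (p m g k1 k2 k3 kappa : R)
    (tau : \bar R) (f : R -> R) (Rot : R -> 'M[R]_3)
    (phiD b v bh vh phih : R -> 'cV[R]_3) :
  locally_ac phiD tau -> ae_before tau (fun t => derivable phiD t 1) ->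
  translational_motion m g tau f Rot phiD b v ->
  extended_state_observer p m g k1 k2 k3 kappa tau f Rot b v bh vh phih ->
  error_dynamics p m k1 k2 k3 kappa tau phiD
    (fun t => b t - bh t) (fun t => v t - vh t) (fun t => phiD t - phih t).
Proof.
move=> acphi dphi [acb acv dm] [acbh acvh acph dobs].
split; [exact: locally_acB..|].
apply: (ae_imp (ae_and dphi (ae_and dm dobs))) => t [h1 [h2 h3]] t0 tt.
have dphit := h1 t0 tt.
have [dbt dvt bE vE] := h2 t0 tt.
have [[dbh [dvh dph]] bhE vhE phE] := h3 t0 tt.
rewrite (derive1B dbt dbh) (derive1B dvt dvh) (derive1B dphit dph) bE bhE phE.
split.
- by split; [exact: derivableB | split; exact: derivableB].
- by [].
- rewrite scalerBr vE vhE.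
  by apply/colP => i; rewrite !mxE; ring.
- by rewrite addrC.
Qed.

Theorem theorem2 (R : realType) (p m g kt1 kt2 kt3 kappat : R)
    (hp : 1 < p < 2) (hm : 0 < m) (hkt3 : 0 < kt3) (hkappat : 1 / 2 < kappat)
    (hkt1 : 0 < kt1) (hkt2 : 0 < kt2) (hA : hurwitz (A_t kt1 kt2)) :
  (forall (tau : \bar R) (f : R -> R) (Rot : R -> 'M[R]_3)
          (phiD b v bh vh phih : R -> 'cV[R]_3),
     (forall t, 0 <= t -> (t%:E < tau)%E -> SO3 (Rot t)) ->
     locally_ac phiD tau ->
     ae_before tau (fun t => derivable phiD t 1) ->
     translational_motion m g tau f Rot phiD b v ->
     extended_state_observer p m g kt1 kt2 kt3 kappat tau f Rot
       b v bh vh phih ->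
     error_dynamics p m kt1 kt2 kt3 kappat tau phiD
       (fun t => b t - bh t) (fun t => v t - vh t)
       (fun t => phiD t - phih t))
  /\ fast_finite_time_stable (error_field p m kt1 kt2 kt3 kappat).
Proof.
split; last exact: error_field_ffts.
by move=> tau f Rot phiD b v bh vh phih _; exact: observer_error_dynamics.
Qed.
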